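(* Fix any integer $k > 1$ with at most two prime factors. (1) If $k$ is odd, then every integer $n \geq 36$ can be written as $n = p + \eta$ for some prime $p < n$ and some $\eta \in \mathbb{S}_k$. (2) If $k$ is even, then every even integer $n \geq 36$ can be written as $n = p + \eta$ for some prime $p < n$ and some $\eta \in \mathbb{S}_k$.
   Context: $\mathbb{S}$ denotes the set of all positive square-free integers (including $1$), and for an integer $k$, $\mathbb{S}_k = \{s \in \mathbb{S} : (s,k) = 1\}$ is the set of positive square-free integers co-prime to $k$, where $(a,b)$ denotes the greatest common divisor. *)

(* Defs.v *)
From mathcomp Require Import all_boot.

Set Implicit Arguments.
Unset Strict Implicit.
Unset Printing Implicit Defensive.

Definition squarefree (s : nat) : Prop :=
  0 < s /\ forall d : nat, d ^ 2 %| s -> d = 1.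

Definition squarefree_coprime (k s : nat) : Prop :=
  squarefree s /\ coprime s k.

(* Main.v *)
(** Given n, some residue class a mod 12 is such that a prime p = a mod 12 makes
    n - p coprime to 3 and not divisible by 4, and odd when n is even. So it
    suffices to find such a p for which n - p avoids the prime factors q >= 5 of k
    (at most two) and all squares r^2, r >= 5 prime. Weigh primes by log p.
    - Chebyshev's method modulo 12 bounds the weight of the whole class below by
      0.223 n: weights g_j with sum g_j / j = 0 are chosen so that
      sum_j g_j log (prod of the N <= n/j, N = a j mod 12) is computed by Stirling's
      formula on one side and, on the other, equals sum_d Lambda(d) H(n/d), where H
      exceeds the indicator of the class only for large arguments.
    - The primes p <= n in one class modulo Q = 12 q or 12 r^2 have weight at most
      about (n/Q) (log Q + sum over p | Q of log p / (p - 1)), since the product of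
      an arithmetic progression of length M with difference Q is divisible by the
      part of M! coprime to Q. The sum over all moduli is at most 0.1972 n, the worst
      case being that 5 and 7 divide k.
    The difference beats the error terms for n >= 400000. Below that, a sieve finds
    for each n three primes r such that n - r (n even) or n - 2 r (n odd) is prime;
    k cannot be divisible by all three. *)
From Stdlib Require Import ZArith Reals Lra Lia.
From HB Require Import structures.
Require Import Defs.
From mathcomp Require Import all_boot.
From mathcomp Require Import zify.

Set Implicit Arguments.
Unset Strict Implicit.
Unset Printing Implicit Defensive.

(* [zify] rebinds the key R to [ring_scope]. *)
Delimit Scope R_scope with R.

(** * Finite sums of reals *)

(** The class modulo 12 is what makes the budget balance. Bounded like the other moduli, the squares
    4 and 9 alone would cost over 0.8 n out of a total weight of about n; the choice of the residue
    a disposes of them, and of the factors 2 and 3 of k, at no cost. The true weight of one class is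
    about n/4, so the lower bound is nearly sharp. The upper bound for one modulus Q is too large by
    a factor of order log Q, which is affordable because the sum of log r / r^2 over primes r >= 5
    is small. Only sums of logarithms over progressions are ever estimated, so every error is
    explicit: terms of order sqrt n log n come from the squares r^2 <= n and from the proper prime
    powers, terms of order log n from Chebyshev's method and the moduli q. They dictate the size of
    the threshold. Below it, the summand eta is r for even n and 2 r for odd n: the factor 2 keeps n
    - eta odd and is harmless because k is then odd. *)

HB.instance Definition _ := Monoid.isComLaw.Build R 0%R Rplus
  (fun x y z => esym (Rplus_assoc x y z)) Rplus_comm Rplus_0_l.
HB.instance Definition _ := Monoid.isMulLaw.Build R 0%R Rmult Rmult_0_l Rmult_0_r.
HB.instance Definition _ := Monoid.isAddLaw.Build R Rmult Rplus
  Rmult_plus_distr_r Rmult_plus_distr_l.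

Notation "\rsum_ ( i <- r | P ) F" := (\big[Rplus/0%R]_(i <- r | P%B) F%R)
  (at level 34, F at level 34, i, r at level 50).
Notation "\rsum_ ( i <- r ) F" := (\big[Rplus/0%R]_(i <- r) F%R)
  (at level 34, F at level 34, i, r at level 50).

Notation upto x := (index_iota 1 x.+1).

Lemma rsum_ge0 (I : eqType) (r : seq I) (P : pred I) (F : I -> R) :
  (forall i, i \in r -> P i -> (0 <= F i)%R) -> (0 <= \rsum_(i <- r | P i) F i)%R.
Proof.
move=> H; rewrite big_seq_cond; apply: (big_ind (fun x => (0 <= x)%R)); first lra.
- by move=> x y; lra.
- by move=> i /andP[]; apply: H.
Qed.

Lemma rsum_le (I : eqType) (r : seq I) (P : pred I) (F G : I -> R) :
  (forall i, i \in r -> P i -> (F i <= G i)%R) ->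
  (\rsum_(i <- r | P i) F i <= \rsum_(i <- r | P i) G i)%R.
Proof.
move=> H; rewrite [X in (X <= _)%R]big_seq_cond [X in (_ <= X)%R]big_seq_cond.
apply: (big_ind2 (fun x y => (x <= y)%R)); first lra.
- by move=> *; lra.
- by move=> i /andP[]; apply: H.
Qed.

Lemma rsum_sub (I : eqType) (r : seq I) (P Q : pred I) (F : I -> R) :
  (forall i, i \in r -> P i -> Q i) ->
  (forall i, i \in r -> Q i -> ~~ P i -> (0 <= F i)%R) ->
  (\rsum_(i <- r | P i) F i <= \rsum_(i <- r | Q i) F i)%R.
Proof.
move=> PQ H; rewrite big_mkcond [X in (_ <= X)%R]big_mkcond.
apply: rsum_le => i ir _; case: ifP => Pi; first by rewrite (PQ i ir Pi); lra.
by case: ifP => Qi; [apply: H => //; rewrite Pi | lra].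
Qed.

Lemma rsum_const (I : Type) (r : seq I) (P : pred I) (c : R) :
  \rsum_(i <- r | P i) c = (INR (count P r) * c)%R.
Proof.
elim: r => [|x r IH]; first by rewrite big_nil /= Rmult_0_l.
rewrite big_cons IH /=; case: (P x) => //.
by rewrite add1n S_INR; lra.
Qed.

Lemma rsum_widen (y x : nat) (P : pred nat) (F : nat -> R) : y <= x ->
  (forall i, y < i <= x -> P i -> F i = 0%R) ->
  \rsum_(i <- upto x | P i) F i = \rsum_(i <- upto y | P i) F i.
Proof.
move=> yx H; rewrite (@big_cat_nat _ _ _ y.+1) //=.
rewrite [X in Rplus _ X]big_nat_cond [X in Rplus _ X]big1 ?Rplus_0_r // => i /andP[/andP[i1 i2] Pi].
by apply: H => //; rewrite i1 -ltnS.
Qed.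

Lemma filter_multiples (d x : nat) : 0 < d ->
  [seq N <- upto x | d %| N] = [seq d * m | m <- upto (x %/ d)].
Proof.
move=> d0; rewrite /index_iota !subn1 /=.
elim: x => [|x IH]; first by rewrite div0n.
rewrite -[x.+1]addn1 iotaD filter_cat IH add1n addn1 divnS //=.
case: ifP => dx; last by rewrite cats0.
by rewrite add1n -[(x %/ d).+1]addn1 iotaD map_cat /= add1n -[(x %/ d).+1]add1n
   -(divnK dx) divnS // dx mulnC.
Qed.

Lemma rsum_multiples (d x : nat) (P : pred nat) (F : nat -> R) : 0 < d ->
  \rsum_(N <- upto x | (d %| N) && P N) F N =
  \rsum_(m <- upto (x %/ d) | P (d * m)) F (d * m)%N.
Proof.
move=> d0.
by rewrite -big_filter_cond filter_multiples // big_map.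
Qed.

(** The representative [a] lies in 1..Q rather than 0..Q-1, so that the first positive term is [a]
    itself; the truncated count is then also right for x < a. *)
Lemma filter_progression (Q a x : nat) : 0 < a <= Q ->
  [seq N <- upto x | N == a %[mod Q]] =
  [seq a + i * Q | i <- iota 0 ((x + Q - a) %/ Q)].
Proof.
move=> /andP[a0 aQ]; have Q0 : 0 < Q by apply: leq_trans aQ.
rewrite /index_iota !subn1 /=; elim: x => [|x IH].
  by rewrite add0n divn_small //; lia.
rewrite -[x.+1]addn1 iotaD filter_cat IH add1n /= addn1.
have -> : x.+1 + Q - a = (x + Q - a).+1 by lia.
rewrite divnS //.
have -> : (x.+1 == a %[mod Q]) = (Q %| (x + Q - a).+1).
  have -> : (x + Q - a).+1 = x.+1 + Q - a by lia.
  by rewrite -eqn_mod_dvd ?modnDr //; lia.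
case: ifP => dx; last by rewrite cats0.
rewrite add1n -[((x + Q - a) %/ Q).+1]addn1 iotaD map_cat /= add0n; congr (_ ++ [:: _]).
have := divnK dx; rewrite divnS // dx; lia.
Qed.

(** * The von Mangoldt function *)

Definition L (n : nat) : R := ln (INR n).

Lemma INR0lt n : 0 < n -> (0 < INR n)%R.
Proof. by move=> n0; apply: lt_0_INR; lia. Qed.

Lemma L1 : L 1 = 0%R. Proof. exact: ln_1. Qed.

Lemma LM m n : 0 < m -> 0 < n -> L (m * n) = (L m + L n)%R.
Proof. by move=> m0 n0; rewrite /L mult_INR ln_mult //; apply: INR0lt. Qed.

Lemma INR_le m n : m <= n -> (INR m <= INR n)%R.
Proof. by move=> mn; apply: le_INR; lia. Qed.

Lemma L_le m n : 0 < m -> m <= n -> (L m <= L n)%R.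
Proof.
move=> m0 mn; have m0' := INR0lt m0; have := INR_le mn => h.
by case: (Rle_lt_or_eq_dec _ _ h) => [lt|e]; [left; apply: ln_increasing|right; rewrite /L e].
Qed.

Lemma L_ge0 n : (0 <= L n)%R.
Proof.
case: n => [|n]; first by rewrite /L /ln; case: (Rlt_dec 0 (INR 0)) => h; [move: (Rlt_irrefl _ h)|right].
by rewrite -L1; apply: L_le.
Qed.

Definition lam (d : nat) : R := if primes d is [:: p] then L p else 0%R.

Lemma lam_ge0 d : (0 <= lam d)%R.
Proof. by rewrite /lam; case: (primes d) => [|p [|q s]]; try lra; apply: L_ge0. Qed.

Lemma lam_prime p : prime p -> lam p = L p.
Proof. by move=> pp; rewrite /lam primes_prime. Qed.

Lemma lam_pexp p k : prime p -> lam (p ^ k.+1) = L p.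
Proof. by move=> pp; rewrite /lam primesX // primes_prime. Qed.

Lemma lamP d : 0 < d -> lam d = 0%R \/ exists p k, [/\ prime p, d = p ^ k.+1 & lam d = L p].
Proof.
move=> d0; rewrite /lam; case E: (primes d) => [|p [|q s]]; [by left| |by left].
have pp : p \in primes d by rewrite E inE.
move: (pp); rewrite mem_primes => /and3P[ppr _ pd]; right; exists p, (logn p d).-1.
have l0 : 0 < logn p d by rewrite logn_gt0.
split=> //; rewrite prednK // {1}(prod_prime_decomp d0) prime_decompE E big_map big_seq1 //.
Qed.

Lemma lam_le d : 0 < d -> (lam d <= L d)%R.
Proof.
move=> d0; case: (lamP d0) => [->|[p [k [pp -> ->]]]]; first exact: L_ge0.
apply: L_le; first exact: prime_gt0.
by rewrite expnS leq_pmulr // expn_gt0 prime_gt0.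
Qed.

Lemma lamM_prime p d : prime p -> 0 < d -> p %| d -> lam (p * d) = lam d.
Proof.
move=> pp d0 pd; case: (lamP d0) => [z|[q [k [qp e l]]]]; last first.
  by move: pd; rewrite e Euclid_dvdX // dvdn_prime2 // andbT => /eqP ->; rewrite -expnS !lam_pexp.
suff -> : lam (p * d) = lam d by [].
rewrite /lam; suff -> : primes (p * d) = primes d by [].
apply: (@irr_sorted_eq _ ltn); try exact: sorted_primes.
- exact: ltn_trans.
- exact: ltnn.
move=> q; rewrite primesM ?(prime_gt0 pp) // primes_prime // !inE.
by case: eqP => // ->; rewrite mem_primes pp d0 pd.
Qed.

Lemma lamM0 p d : prime p -> 1 < d -> ~~ (p %| d) -> lam (p * d) = 0%R.
Proof.
move=> pp d1 pd; have d0 : 0 < d by lia.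
have pdgt : 0 < p * d by rewrite muln_gt0 prime_gt0.
case: (lamP pdgt) => // [[q [k [qp e _]]]]; exfalso.
have pq : p = q.
  have : p %| q ^ k.+1 by rewrite -e dvdn_mulr.
  by rewrite Euclid_dvdX // dvdn_prime2 // andbT => /eqP.
subst q; move/eqP: e; rewrite expnS eqn_pmul2l ?prime_gt0 // => /eqP e.
by move: pd d1; rewrite e; case: (k) => [|m]; rewrite ?expnS ?dvdn_mulr.
Qed.

(** Induction along N = p m. A divisor of N that does not divide m contains the full power of p in
    N; the only prime power among these is p^(v+1), v being the exponent of p in m, and it
    contributes log p. *)
Lemma sum_lam_divisors N : 0 < N -> \rsum_(d <- upto N | d %| N) lam d = L N.
Proof.
elim/ltn_ind: N => N IH N0.
have [N1|N1] := leqP N 1.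
  have -> : N = 1 by lia.
  by rewrite L1 /index_iota /= big_cons big_nil /= /lam /= Rplus_0_l.
have [p pp pN] : exists2 p, prime p & p %| N by exists (pdiv N); [exact: pdiv_prime|exact: pdiv_dvd].
have [m Nm] : exists m, N = p * m by exists (N %/ p); rewrite mulnC divnK.
have p1 := prime_gt1 pp.
have m0 : 0 < m by move: N0; rewrite Nm muln_gt0 => /andP[].
have mN : m < N by rewrite Nm ltn_Pmull.
have -> : L N = (L p + L m)%R by rewrite Nm LM ?(prime_gt0 pp).
rewrite -(IH m mN m0).
rewrite (bigID (fun d => d %| m)) /= Rplus_comm; congr Rplus.
  have eN : p ^ (logn p m).+1 %| N by rewrite Nm expnS dvdn_pmul2l ?prime_gt0 // pfactor_dvdnn.
  have enm : ~~ (p ^ (logn p m).+1 %| m) by rewrite pfactor_dvdn // ltnn.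
  rewrite big_mkcond (bigD1_seq (p ^ (logn p m).+1)) ?iota_uniq //=; last first.
    by rewrite mem_index_iota ltnS expn_gt0 prime_gt0 //= dvdn_leq.
  rewrite eN enm /= lam_pexp // big1 ?Rplus_0_r // => d de; case: ifP => // /andP[dN dm].
  have d0 : 0 < d by apply: dvdn_gt0 dN.
  case: (lamP d0) => // [[q [k [qp e _]]]]; exfalso.
  have [pq|pq] := eqVneq q p.
    subst q; move: dN dm de; rewrite e !pfactor_dvdn // Nm lognM ?(prime_gt0 pp) // logn_prime // eqxx.
    rewrite eqn_exp2l // ; lia.
  have cp : coprime d p by rewrite e coprimeXl // prime_coprime // dvdn_prime2 // eq_sym.
  by move: dN; rewrite Nm Gauss_dvdr // (negbTE dm).
rewrite (eq_bigl (fun d => d %| m)); last first.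
  by move=> d /=; case dm: (d %| m); rewrite ?andbF // Nm dvdn_mull.
apply: rsum_widen; first exact: ltnW.
by move=> i /andP[mi _] im; have := dvdn_leq m0 im; lia.
Qed.

(** * Prime powers in arithmetic progressions: upper bounds *)

Definition psi (P : pred nat) (x : nat) : R := \rsum_(d <- upto x | P d) lam d.

Lemma L_sum_lam N x : 0 < N <= x -> L N = \rsum_(d <- upto x | d %| N) lam d.
Proof.
move=> /andP[N0 Nx]; rewrite (@rsum_widen N) ?sum_lam_divisors //.
by move=> i /andP[Ni _] iN; have := dvdn_leq N0 iN; lia.
Qed.

(** Legendre's formula for a general product: a prime power d contributes [lam d] once for every
    factor that it divides. *)
Lemma rsum_L_lam (I : eqType) (r : seq I) (P : pred I) (F : I -> nat) x :
  (forall i, i \in r -> P i -> 0 < F i <= x) ->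
  \rsum_(i <- r | P i) L (F i) =
  \rsum_(d <- upto x) (lam d * INR (count (fun i => P i && (d %| F i)) r)).
Proof.
move=> H; rewrite big_seq_cond.
rewrite (eq_bigr (fun i => \rsum_(d <- upto x | d %| F i) lam d)); last first.
  by move=> i /andP[ir Pi]; apply: L_sum_lam; apply: H.
rewrite -big_seq_cond (exchange_big_dep predT) //=.
by apply: eq_bigr => d _; rewrite rsum_const Rmult_comm.
Qed.

Lemma exists_multiple_in_block d Q a s : 0 < d -> coprime d Q ->
  exists2 i, s <= i < s + d & d %| a + i * Q.
Proof.
move=> d0 cdQ; have [Q0|Q0] := posnP Q.
  exists s; first by lia.
  by move: cdQ; rewrite Q0 /coprime gcdn0 => /eqP ->; exact: dvd1n.
case: (egcdnP d Q0) => u v e _; rewrite gcdnC (eqP cdQ) in e.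
(* Here u Q = 1 modulo d and [d.-1] plays the part of -1, so that i0 Q = -a modulo d. *)
pose i0 := u * (a * d.-1).
have di0 : d %| a + i0 * Q.
  apply/dvdnP; exists (a + a * d.-1 * v); rewrite /i0 -mulnA [_ * Q]mulnC mulnA e; nia.
(* The element of the block that is congruent to i0 modulo d; again s (d-1) stands for -s. *)
exists (s + (i0 + s * d.-1) %% d); first by rewrite leq_addr ltn_add2l ltn_mod.
have := divn_eq (i0 + s * d.-1) d; set r := _ %% d; set q := _ %/ d => E.
rewrite -(dvdn_addl _ (_ : d %| q * d * Q)); last by rewrite -mulnA mulnCA dvdn_mulr.
have -> : a + (s + r) * Q + q * d * Q = a + i0 * Q + s * d * Q by nia.
by apply: dvdn_add => //; rewrite -mulnA mulnCA dvdn_mulr.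
Qed.

Lemma count_multiples_progression d Q a M : 0 < d -> coprime d Q ->
  M %/ d <= count (fun i => d %| a + i * Q) (iota 0 M).
Proof.
move=> d0 cdQ.
have H k : k <= count (fun i => d %| a + i * Q) (iota 0 (k * d)).
  elim: k => // k IH; rewrite mulSn addnC iotaD count_cat add0n -addn1.
  apply: leq_add => //; rewrite -has_count; apply/hasP.
  have [i ir di] := exists_multiple_in_block a (k * d) d0 cdQ.
  by exists i => //; rewrite mem_iota.
apply: leq_trans (H _) _.
by rewrite {2}(divn_eq M d) iotaD count_cat leq_addr.
Qed.

(** By Legendre's formula, the logarithm of the part of M! built from the primes dividing Q. *)
Definition ncop_part (Q M : nat) : R :=
  \rsum_(d <- upto M | ~~ coprime d Q) (lam d * INR (M %/ d)).

Lemma rsum_L_fact M :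
  \rsum_(N <- upto M) L N = \rsum_(d <- upto M) (lam d * INR (M %/ d)).
Proof.
rewrite (@rsum_L_lam _ _ _ _ M); last by move=> i; rewrite mem_index_iota; lia.
apply: eq_big_seq => d; rewrite mem_index_iota => /andP[d0 _]; congr (_ * INR _)%R => /=.
by rewrite -size_filter filter_multiples // size_map size_iota subn1.
Qed.

(* The product of a progression of length M is divisible by the part of M!
   coprime to the modulus, and prime powers d > M of the progression come on
   top of that. *)
Lemma psi_progression_step Q a M : 0 < a <= Q -> coprime a Q -> 
  (psi (fun d => (d == a %[mod Q])) (M * Q)
   <= INR M * L Q + ncop_part Q M + psi (fun d => (d == a %[mod Q])) M)%R.
Proof.
move=> aQ caQ; have Q0 : 0 < Q by lia.
pose F i := a + i * Q.
have Fb i : i < M -> 0 < F i <= M * Q by rewrite /F; nia.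
have up : (\rsum_(i <- iota 0 M) L (F i) <= INR M * L Q + \rsum_(N <- upto M) L N)%R.
  have -> : (INR M * L Q = \rsum_(i <- iota 0 M) L Q)%R.
    by rewrite rsum_const count_predT size_iota.
  rewrite /index_iota subn1 /= -[1]addn0 iotaDl big_map -big_split /=.
  apply: rsum_le => i; rewrite mem_iota => /andP[_ iM] _.
  (* a + i Q <= (i + 1) Q, so the product of the progression is at most Q^M M!. *)
  by rewrite -LM //; apply: L_le; rewrite /F; nia.
rewrite (@rsum_L_lam _ _ _ _ (M * Q)) in up; last first.
  by move=> i; rewrite mem_iota => /andP[_ iM] _; apply: Fb.
rewrite rsum_L_fact in up.
have lo : (\rsum_(d <- upto M | coprime d Q) (lam d * INR (M %/ d)) +
   psi (fun d => (d == a %[mod Q])) (M * Q) - psi (fun d => (d == a %[mod Q])) M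
   <= \rsum_(d <- upto (M * Q)) (lam d * INR (count (fun i => true && (d %| F i)) (iota 0 M))))%R.
  have MQ : M <= M * Q by rewrite leq_pmulr.
  rewrite /psi !(@big_cat_nat _ _ _ M.+1 1 (M * Q).+1) //=.
  set A := \rsum_(d <- upto M | coprime d Q) _.
  set B := \rsum_(d <- upto M) _.
  have AB : (A <= B)%R.
    rewrite /A big_mkcond; apply: rsum_le => d; rewrite mem_index_iota => /andP[d0 dM] _.
    have ld := lam_ge0 d; case: ifP => cdQ; last by apply: Rmult_le_pos => //; apply: pos_INR.
    apply: Rmult_le_compat_l => //; apply: INR_le; exact: count_multiples_progression.
  set C := bigop _ _ _; set D := bigop _ _ _; set E := bigop _ _ _.
  suff : (D <= E)%R by lra.
  rewrite /D /E big_mkcond; apply: rsum_le => d; rewrite mem_index_iota => /andP[dM dX] _.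
  have ld := lam_ge0 d; case: ifP => da; last by apply: Rmult_le_pos => //; apply: pos_INR.
  rewrite -[X in (X <= _)%R]Rmult_1_r; apply: Rmult_le_compat_l => //.
  apply: (@INR_le 1); rewrite -has_count; apply/hasP.
  have : d \in [seq N <- upto (M * Q) | N == a %[mod Q]] by rewrite mem_filter da mem_index_iota; lia.
  rewrite filter_progression // => /mapP[i]; rewrite mem_iota => /andP[_ ik] ->.
  exists i; last by rewrite /F dvdnn.
  rewrite mem_iota /= add0n; apply: leq_trans ik _.
  by rewrite add0n -ltnS ltn_divLR //; nia.
have -> : ncop_part Q M = (\rsum_(d <- upto M) (lam d * INR (M %/ d)) -
   \rsum_(d <- upto M | coprime d Q) (lam d * INR (M %/ d)))%R.
  by rewrite (bigID (fun d => coprime d Q)) /= /ncop_part; lra.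
have {up} := Rle_trans _ _ _ lo up; lra.
Qed.

Lemma psi_mono P x y : x <= y -> (psi P x <= psi P y)%R.
Proof.
move=> xy; rewrite /psi (@big_cat_nat _ _ _ x.+1 1 y.+1) //=.
set A := bigop _ _ _; set B := bigop _ _ _.
suff : (0 <= B)%R by lra.
by apply: rsum_ge0 => i _ _; apply: lam_ge0.
Qed.

Lemma psi_sub (P P' : pred nat) x : (forall d, P d -> P' d) -> (psi P x <= psi P' x)%R.
Proof. by move=> PP'; apply: rsum_sub => [i _|i _ _ _]; [apply: PP'|apply: lam_ge0]. Qed.

Lemma INR_divn_le m d : (INR (m %/ d) <= INR m / INR d)%R.
Proof.
case: d => [|d]; first by rewrite divn0 /= /Rdiv Rinv_0; lra.
have d0 := @INR0lt d.+1 isT.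
apply: (Rmult_le_reg_r (INR d.+1)) => //.
rewrite -mult_INR /Rdiv Rmult_assoc Rinv_l; last by lra.
by rewrite Rmult_1_r; apply: INR_le; apply: leq_divM.
Qed.

(** The exponent of p in M! is at most M / (p - 1). Writing d = p m, the term m = 1 gives u log p
    with u = M / p rounded down, and the terms with p | m reproduce the sum for u; the induction
    closes since u (1 + 1/(p-1)) = u p / (p-1) <= M / (p-1). *)
Lemma sum_lam_p_part_divn_le p M : prime p ->
  (\rsum_(d <- upto M | p %| d) (lam d * INR (M %/ d)) <= INR M * (L p / (INR p - 1)))%R.
Proof.
move=> pp; have p0 := prime_gt0 pp; have p1 := prime_gt1 pp.
have p2 : (2 <= INR p)%R by apply: (@INR_le 2).
have Lp := L_ge0 p.
elim/ltn_ind: M => M IH.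
have [M0|M0] := posnP M.
  by rewrite M0 /index_iota /= big_nil /= Rmult_0_l; apply: Rle_refl.
rewrite (eq_bigl (fun d => (p %| d) && true)); last by move=> d; rewrite andbT.
rewrite rsum_multiples //.
have [Mp|Mp] := posnP (M %/ p).
  rewrite Mp /index_iota /= big_nil /=; apply: Rmult_le_pos; first exact: pos_INR.
  by apply: Rmult_le_pos => //; left; apply: Rinv_0_lt_compat; lra.
have lt : M %/ p < M by rewrite ltn_Pdiv.
rewrite big_ltn // muln1 lam_prime //.
set S := bigop _ _ _.
have : (S <= INR (M %/ p) * (L p / (INR p - 1)))%R.
  apply: Rle_trans (IH _ lt); rewrite [X in (_ <= X)%R]big_ltn_cond //.
  rewrite dvdn1 gtn_eqF // /S [X in (_ <= X)%R]big_mkcond /=.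
  apply: rsum_le => m; rewrite mem_index_iota => /andP[m1 _] _.
  have m0 : 0 < m by lia.
  rewrite divnMA; case: ifP => pm; first by rewrite lamM_prime //; apply: Rle_refl.
  by rewrite lamM0 ?pm // Rmult_0_l; apply: Rle_refl.
have := INR_divn_le M p; set u := INR (M %/ p); set m := INR M => h1 h2.
have k0 : (0 <= L p / (INR p - 1))%R.
  by apply: Rmult_le_pos => //; left; apply: Rinv_0_lt_compat; lra.
have e : (L p * u + u * (L p / (INR p - 1)) = u * INR p * (L p / (INR p - 1)))%R by field; lra.
have : (u * INR p * (L p / (INR p - 1)) <= m * (L p / (INR p - 1)))%R.
  apply: Rmult_le_compat_r => //; apply: (Rmult_le_reg_r (/ INR p)).
    by apply: Rinv_0_lt_compat; lra.
  by rewrite Rmult_assoc Rinv_r ?Rmult_1_r //; lra.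
lra.
Qed.

Definition kappa (Q : nat) : R := (L Q + \rsum_(p <- primes Q) (L p / (INR p - 1)))%R.

Lemma ncop_part_le Q M : 0 < Q ->
  (ncop_part Q M <= INR M * \rsum_(p <- primes Q) (L p / (INR p - 1)))%R.
Proof.
move=> Q0; rewrite big_distrr /=.
apply: (@Rle_trans _ (\rsum_(p <- primes Q)
    \rsum_(d <- upto M | p %| d) (lam d * INR (M %/ d)))); last first.
  by apply: rsum_le => p; rewrite mem_primes => /andP[pp _] _; apply: sum_lam_p_part_divn_le.
rewrite (exchange_big_dep predT) //= /ncop_part big_mkcond.
apply: rsum_le => d; rewrite mem_index_iota => /andP[d0 _] _.
have F0 : (0 <= lam d * INR (M %/ d))%R by apply: Rmult_le_pos; [apply: lam_ge0|apply: pos_INR].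
case: ifP => cdQ; last by apply: rsum_ge0.
have [p] : exists2 p, p \in primes Q & p %| d.
  exists (pdiv (gcdn d Q)).
    rewrite mem_primes Q0 pdiv_prime ?(dvdn_trans (pdiv_dvd _)) ?dvdn_gcdr //.
    by rewrite ltn_neqAle gcdn_gt0 Q0 orbT andbT eq_sym; rewrite /coprime in cdQ; rewrite cdQ.
  by rewrite (dvdn_trans (pdiv_dvd _)) ?dvdn_gcdl.
move=> pQ pd; rewrite big_mkcond (bigD1_seq p) ?primes_uniq //= pd.
set S := bigop _ _ _; suff : (0 <= S)%R by lra.
by apply: rsum_ge0 => i _ _; case: ifP => // _; apply: Rle_refl.
Qed.

(** Iterates [psi_progression_step] from x to M, the quotient x / Q rounded up, until nothing is
    left. The geometric series turns x / Q into x / (Q - 1); [s] bounds the number of rounds, each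
    of which pays Q / (Q - 1) for the rounding. *)
Lemma psi_class_le Q a s x : 1 < Q -> 0 < a <= Q -> coprime a Q -> x <= Q ^ s ->
  (psi (fun d => (d == a %[mod Q])) x
   <= kappa Q * ((INR x + INR s * INR Q) / (INR Q - 1)))%R.
Proof.
move=> Q1 aQ caQ; have Q0 : 0 < Q by lia.
have Q2 : (2 <= INR Q)%R by apply: (@INR_le 2).
have k0 : (0 <= kappa Q)%R.
  have := L_ge0 Q; rewrite /kappa; set S := bigop _ _ _.
  suff : (0 <= S)%R by lra.
  apply: rsum_ge0 => p; rewrite mem_primes => /andP[/prime_gt1 pp _] _.
  have := L_ge0 p; have : (2 <= INR p)%R by apply: (@INR_le 2).
  by move=> *; apply: Rmult_le_pos => //; left; apply: Rinv_0_lt_compat; lra.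
have i0 : (0 < / (INR Q - 1))%R by apply: Rinv_0_lt_compat; lra.
elim: s x => [|s IH] x xs.
  rewrite /psi; apply: (@Rle_trans _ 0%R).
    rewrite big_nat_cond big1; first exact: Rle_refl.
    move=> i /andP[/andP[i1 ix] _]; rewrite expn0 in xs.
    have -> : i = 1 by lia.
    by rewrite /lam.
  apply: Rmult_le_pos => //; apply: Rmult_le_pos; last by lra.
  by have := pos_INR x; rewrite Rmult_0_l; lra.
pose M := (x + Q.-1) %/ Q.
have xM : x <= M * Q.
  rewrite /M; have := divn_eq (x + Q.-1) Q; have := ltn_pmod (x + Q.-1) Q0; lia.
have Mx : (INR M <= INR x / INR Q + 1)%R.
  apply: (Rmult_le_reg_r (INR Q)); first by lra.
  have -> : ((INR x / INR Q + 1) * INR Q = INR x + INR Q)%R by field; lra.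
  rewrite -mult_INR -plus_INR; apply: INR_le; apply: leq_trans (leq_divM _ _) _; lia.
have Ms : M <= Q ^ s.
  rewrite -ltnS ltn_divLR // mulSn mulnC -expnS; lia.
apply: Rle_trans (psi_mono _ xM) _.
apply: Rle_trans (psi_progression_step M aQ caQ) _.
have := ncop_part_le M Q0; have := IH _ Ms.
set A := psi _ _; set B := ncop_part _ _; rewrite S_INR.
set S := bigop _ _ _ => hA hB.
have : (INR M * L Q + B + A <= kappa Q * (INR M + (INR M + INR s * INR Q) / (INR Q - 1)))%R.
  by move: hA; rewrite /kappa -/S; lra.
move=> h; apply: Rle_trans h _; apply: Rmult_le_compat_l => //.
have -> : (INR M + (INR M + INR s * INR Q) / (INR Q - 1) =
          (INR M * INR Q + INR s * INR Q) / (INR Q - 1))%R by field; lra.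
apply: Rmult_le_compat_r; first by lra.
have : (INR M * INR Q <= (INR x / INR Q + 1) * INR Q)%R by apply: Rmult_le_compat_r => //; lra.
have -> : ((INR x / INR Q + 1) * INR Q = INR x + INR Q)%R by field; lra.
lra.
Qed.

(** * Sums of logarithms over a residue class *)

(** The antiderivative of ln. *)
Definition xlnx (t : R) : R := (t * ln t - t)%R.

Lemma ln_le_sub1 t : (0 < t -> ln t <= t - 1)%R.
Proof. by move=> t0; have := exp_ineq1_le (ln t); rewrite exp_ln //; lra. Qed.

Lemma ln_ge_1subV t : (0 < t -> 1 - / t <= ln t)%R.
Proof.
move=> t0; have := ln_le_sub1 (Rinv_0_lt_compat _ t0); rewrite ln_Rinv //; lra.
Qed.

Lemma ln_div a b : (0 < a -> 0 < b -> ln (a / b) = ln a - ln b)%R.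
Proof.
by move=> a0 b0; rewrite /Rdiv ln_mult ?ln_Rinv //; apply: Rinv_0_lt_compat.
Qed.

Lemma xlnx_incr_ge a b : (0 < a -> a <= b -> (b - a) * ln a <= xlnx b - xlnx a)%R.
Proof.
move=> a0 ab; have b0 : (0 < b)%R by lra.
have q0 : (0 < b / a)%R by apply: Rdiv_lt_0_compat.
have := ln_ge_1subV q0; rewrite ln_div // => h.
have : (b * (1 - / (b / a)) <= b * (ln b - ln a))%R by apply: Rmult_le_compat_l => //; lra.
have -> : (b * (1 - / (b / a)) = b - a)%R by field; lra.
rewrite /xlnx; lra.
Qed.

Lemma xlnx_incr_le a b : (0 < a -> a <= b -> xlnx b - xlnx a <= (b - a) * ln b)%R.
Proof.
move=> a0 ab; have b0 : (0 < b)%R by lra.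
have q0 : (0 < b / a)%R by apply: Rdiv_lt_0_compat.
have := ln_le_sub1 q0; rewrite ln_div // => h.
have : (a * (ln b - ln a) <= a * (b / a - 1))%R by apply: Rmult_le_compat_l => //; lra.
have -> : (a * (b / a - 1) = b - a)%R by field; lra.
rewrite /xlnx; lra.
Qed.

Lemma ln_le a b : (0 < a -> a <= b -> ln a <= ln b)%R.
Proof. by move=> a0 [ab|->]; [left; apply: ln_increasing|right]. Qed.

Lemma ln_ge0 a : (1 <= a -> 0 <= ln a)%R.
Proof. by move=> a1; rewrite -ln_1; apply: ln_le; lra. Qed.

Lemma xlnx_mono a b : (1 <= a -> a <= b -> xlnx a <= xlnx b)%R.
Proof.
move=> a1 ab; have := @xlnx_incr_ge a b; have := ln_ge0 a1.
move=> h /(_ ltac:(lra) ab); have : (0 <= (b - a) * ln a)%R by apply: Rmult_le_pos; lra.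
lra.
Qed.

(** Left and right Riemann sums of mesh Q for the increasing function ln enclose its integral. *)
Lemma sum_ln_progression c Q k : 0 < c ->
  (INR Q * \rsum_(i <- iota 0 k) L (c + i * Q) <= xlnx (INR (c + k * Q)) - xlnx (INR c)
   <= INR Q * \rsum_(i <- iota 1 k) L (c + i * Q))%R.
Proof.
move=> c0; elim: k => [|k [IH1 IH2]]; first by rewrite /= !big_nil mul0n addn0; lra.
have p i : (0 < INR (c + i * Q))%R by apply: INR0lt; lia.
have le : (INR (c + k * Q) <= INR (c + k.+1 * Q))%R by apply: INR_le; nia.
have e : (INR (c + k.+1 * Q) - INR (c + k * Q) = INR Q)%R.
  by rewrite mulSn !plus_INR !mult_INR; lra.
have := xlnx_incr_ge (p k) le; have := xlnx_incr_le (p k) le; rewrite e.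
rewrite -/(L _) -/(L _) -[k.+1]addn1 !iotaD !big_cat /= !big_cons !big_nil /= add0n add1n addn1 => h1 h2.
split; lra.
Qed.

Lemma xlnx_ge t : (0 < t -> -1 <= xlnx t)%R.
Proof.
move=> t0; have := ln_ge_1subV t0 => h; rewrite /xlnx.
have : (t * (1 - / t) <= t * ln t)%R by apply: Rmult_le_compat_l => //; lra.
have -> : (t * (1 - / t) = t - 1)%R by field; lra.
lra.
Qed.

(** [z] will be the unrounded quotient x / j, with [y] its integer part: main terms expressed
    through z rather than y cancel exactly in [lower_log_sum]. The 1 in the error is the bound -1 <=
    [xlnx] at the start of the progression. *)
Lemma sum_L_class Q c y z : 0 < c <= Q -> 0 < y -> (INR y <= z < INR y + 1)%R ->
  (Rabs (INR Q * \rsum_(N <- upto y | N == c %[mod Q]) L N - xlnx z) <= INR Q * ln z + 1)%R.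
Proof.
move=> cQ y0 [yz zy]; have [c0 cQ'] := andP cQ.
rewrite -big_filter filter_progression // big_map.
have y1 : (1 <= INR y)%R by apply: (@INR_le 1).
have lz : (0 <= ln z)%R by apply: ln_ge0; lra.
have Qc : (1 <= INR c <= INR Q)%R by split; [apply: (@INR_le 1)|apply: INR_le].
have lc : (0 <= ln (INR c))%R by apply: ln_ge0; lra.
have fz := @xlnx_ge z ltac:(lra).
case E : ((y + Q - c) %/ Q) => [|k].
  have yc : y < c.
    rewrite ltnNge; apply/negP => cy.
    have : 0 < (y + Q - c) %/ Q by rewrite divn_gt0; lia.
    by rewrite E.
  have zQ : (z <= INR Q)%R.
    by have := @INR_le y.+1 Q ltac:(lia); rewrite S_INR; lra.
  rewrite /= big_nil Rmult_0_r Rminus_0_l Rabs_Ropp; apply: Rabs_le; split; first nra.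
  by rewrite /xlnx; nra.
have /andP[ky yk] : c + k * Q <= y < c + k.+1 * Q.
  have := divn_eq (y + Q - c) Q; rewrite E.
  have := @ltn_pmod (y + Q - c) Q ltac:(lia); lia.
set N := (c + k * Q)%N in ky.
have Nz : (INR N <= z)%R by have := INR_le ky; lra.
have zN : (z - INR N <= INR Q)%R.
  have := @INR_le y.+1 (N + Q) ltac:(rewrite /N; lia); rewrite S_INR plus_INR; lra.
have N1 : (1 <= INR N)%R by apply: (@INR_le 1); rewrite /N; lia.
have [lo _] := sum_ln_progression Q k c0.
have [_ hi] := sum_ln_progression Q k c0.
have fNz := xlnx_mono N1 Nz.
have fzN := @xlnx_incr_le (INR N) z ltac:(lra) Nz.
have lNz : (ln (INR N) <= ln z)%R by apply: ln_le; lra.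
have fc := @xlnx_ge (INR c) ltac:(lra).
apply: Rabs_le; split.
  rewrite /= big_cons mul0n addn0 -/(L c).
  have : (xlnx (INR c) <= INR Q * L c)%R by rewrite /xlnx /L; nra.
  have : ((z - INR N) * ln z <= INR Q * ln z)%R by apply: Rmult_le_compat_r.
  rewrite -/N in hi; set S := bigop _ _ _ in hi *; lra.
rewrite -[k.+1]addn1 iotaD big_cat /= big_cons big_nil add0n -/N.
have : (INR Q * L N <= INR Q * ln z)%R by apply: Rmult_le_compat_l => //; lra.
rewrite -/N in lo; set S := bigop _ _ _ in lo *; lra.
Qed.

(** * Weighted Chebyshev method modulo 12 *)

(** The Dirichlet convolution of g, supported on [js], with the constant 1. Its sums [wsum] over a
    residue class are the H of the overview. *)
Definition wconv (js : seq nat) (g : nat -> R) (m : nat) : R :=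
  \rsum_(j <- js | j %| m) g j.

Definition wsum (js : seq nat) (g : nat -> R) (b y : nat) : R :=
  \rsum_(m <- upto y | m == b %[mod 12]) wconv js g m.

Lemma rsum_count (I : Type) (r : seq I) (P : pred I) (c : R) :
  (c * INR (count P r))%R = \rsum_(i <- r | P i) c.
Proof. by rewrite rsum_const Rmult_comm. Qed.

(** Both sides sum g(j) lam(d) over all products j d k <= x satisfying P, grouped by j or by d. *)
Lemma weighted_log_identity (js : seq nat) (g : nat -> R) (P : pred nat) x :
  (forall j, j \in js -> 0 < j) ->
  \rsum_(j <- js) (g j * \rsum_(N <- upto (x %/ j) | P (j * N)%N) L N) =
  \rsum_(d <- upto x) (lam d * \rsum_(m <- upto (x %/ d) | P (d * m)%N) wconv js g m).
Proof.
move=> js0.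
transitivity (\rsum_(j <- js) \rsum_(d <- upto x)
   (lam d * (g j * INR (count (fun k => P (j * d * k)%N) (upto (x %/ j %/ d)))))).
  apply: eq_big_seq => j jj; rewrite (@rsum_L_lam _ _ _ _ x); last first.
    move=> i; rewrite mem_index_iota => /andP[i0 ix] _; rewrite i0 /=.
    by apply: leq_trans (leq_div x j).
  rewrite big_distrr /=; apply: eq_big_seq => d; rewrite mem_index_iota => /andP[d0 _].
  rewrite -Rmult_assoc [(g j * _)%R]Rmult_comm Rmult_assoc; congr (_ * (_ * INR _))%R.
  rewrite -!sum1_count.
  rewrite (eq_bigl (fun N => (d %| N) && P (j * N)%N)); last by move=> N; rewrite andbC.
  rewrite -big_filter_cond filter_multiples // big_map.
  by apply: eq_bigl => k; rewrite mulnA.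
rewrite exchange_big /=; apply: eq_big_seq => d; rewrite mem_index_iota => /andP[d0 _].
rewrite -big_distrr /=; congr Rmult.
rewrite (exchange_big_dep predT) //=; apply: eq_big_seq => j jj.
rewrite -rsum_count; congr (_ * INR _)%R; apply: esym; rewrite -!sum1_count.
rewrite (eq_bigl (fun N => (j %| N) && P (d * N)%N)); last by move=> N; rewrite andbC.
rewrite -big_filter_cond filter_multiples ?js0 // big_map -!divnMA [(d * j)%N]mulnC.
by apply: eq_bigl => k; rewrite mulnA [(d * j)%N]mulnC.
Qed.

(* Every unit modulo 12 is its own inverse. *)
Lemma sqr_unit12 j : coprime j 12 -> j * j = 1 %[mod 12].
Proof.
rewrite -coprime_modl -modnMm; have : j %% 12 < 12 by rewrite ltn_mod.
by move: (j %% 12); do 12 case=> //.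
Qed.

Lemma unit12_mod_swap j N a : coprime j 12 ->
  (j * N == a %[mod 12]) = (N == j * a %[mod 12]).
Proof.
move=> /sqr_unit12 jj; have K n : j * (j * n) = n %[mod 12].
  by rewrite mulnA -modnMml jj modnMml mul1n.
apply/eqP/eqP => [e|e].
  by rewrite -[in LHS]K -modnMmr e modnMmr.
by rewrite -modnMmr e modnMmr K.
Qed.

Lemma unit12_mod c : coprime c 12 -> 0 < c %% 12 <= 12 /\ coprime (c %% 12) 12.
Proof.
move=> cc; have c1 : coprime (c %% 12) 12 by rewrite coprime_modl.
split=> //; apply/andP; split; last by apply: ltnW; rewrite ltn_mod.
by rewrite lt0n; apply: contraL c1 => /eqP ->.
Qed.

Lemma lower_log_sum (js : seq nat) (g : nat -> R) a x :
  (forall j, j \in js -> 0 < j <= x) -> {in js, forall j, coprime j 12} -> coprime a 12 ->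
  \rsum_(j <- js) (g j / INR j) = 0%R ->
  (- INR x * \rsum_(j <- js) (g j * L j / INR j)
   - (\rsum_(j <- js) Rabs (g j)) * (12 * L x + 1)
   <= 12 * \rsum_(j <- js) (g j * \rsum_(N <- upto (x %/ j) | (j * N)%N == a %[mod 12]) L N))%R.
Proof.
move=> jb jc ca g0.
(* In [xlnx] (x / j) = (x / j) (log x - 1) - x log j / j the first part is proportional to 1 / j,
   hence disappears by the hypothesis on the weights. *)
have e : (\rsum_(j <- js) (g j * xlnx (INR x / INR j)) =
          - INR x * \rsum_(j <- js) (g j * L j / INR j))%R.
  transitivity ((INR x * (L x - 1)) * \rsum_(j <- js) (g j / INR j) +
     - INR x * \rsum_(j <- js) (g j * L j / INR j))%R; last by rewrite g0; lra.
  rewrite !big_distrr -big_split /=; apply: eq_big_seq => j /jb/andP[j0 jx].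
  have j0' := INR0lt j0; have x0' : (0 < INR x)%R by apply: INR0lt; lia.
  by rewrite /xlnx ln_div // /L; field; lra.
rewrite -e !big_distrr /=.
have -> : ((\rsum_(j <- js) Rabs (g j)) * (12 * L x + 1) =
  \rsum_(j <- js) (Rabs (g j) * (12 * L x + 1)))%R by rewrite big_distrl.
suff : (\rsum_(j <- js) (g j * xlnx (INR x / INR j)) <=
  \rsum_(j <- js) ((12 * (g j * \rsum_(N <- upto (x %/ j) | (j * N)%N == a %[mod 12]) L N)) +
    Rabs (g j) * (12 * L x + 1)))%R by rewrite big_split /=; lra.
apply: rsum_le => j jj _; have /andP[j0 jx] := jb j jj.
have j0' := INR0lt j0; have x0 : 0 < x by lia.
have x0' := INR0lt x0.
rewrite (eq_bigl (fun N => N == (j * a) %% 12 %[mod 12])); last first.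
  by move=> N; rewrite unit12_mod_swap ?jc // modn_mod.
set c := (j * a) %% 12.
have cja : coprime (j * a) 12 by rewrite coprimeMl jc.
have [c12 _] := unit12_mod cja.
have y0 : 0 < x %/ j by rewrite divn_gt0.
have zE : (INR (x %/ j) <= INR x / INR j < INR (x %/ j) + 1)%R.
  split; first exact: INR_divn_le.
  apply: (Rmult_lt_reg_r (INR j)) => //; rewrite /Rdiv Rmult_assoc Rinv_l ?Rmult_1_r; last by lra.
  have h : x < (x %/ j).+1 * j by rewrite -ltn_divLR.
  by rewrite -S_INR -mult_INR; apply: lt_INR; apply/ltP.
have := sum_L_class c12 y0 zE; rewrite -/c.
set T := bigop _ _ _; have -> : INR 12 = 12%R by rewrite /=; lra.
have lz : (ln (INR x / INR j) <= L x)%R.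
  apply: ln_le; first by apply: Rdiv_lt_0_compat.
  have : (1 <= INR j)%R by apply: (@INR_le 1).
  move=> h; apply: (Rmult_le_reg_r (INR j)) => //; rewrite /Rdiv Rmult_assoc Rinv_l; nra.
set f := xlnx _ => h.
have h2 : (Rabs (12 * T - f) <= 12 * L x + 1)%R by lra.
have : (Rabs (g j * (f - 12 * T)) <= Rabs (g j) * (12 * L x + 1))%R.
  rewrite Rabs_mult; apply: Rmult_le_compat_l; first exact: Rabs_pos.
  by rewrite Rabs_minus_sym.
have := Rle_abs (g j * (f - 12 * T)); lra.
Qed.

(** The prime power d meets the class b = d a, and b = 1 exactly when d = a modulo 12, units being
    self-inverse; this is the indicator to be isolated. An entry (b, v, w) of [maj] allows an excess
    w / D once x / d >= v, that is for d <= x / v in the class of a b, and [psi_class_le] bounds the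
    total weight of those d. *)
Lemma psi12_lower (js : seq nat) (g : nat -> R) (maj : seq (nat * nat * nat)) (D : R) a x s :
  (forall j, j \in js -> 0 < j <= x) -> {in js, forall j, coprime j 12} -> coprime a 12 ->
  \rsum_(j <- js) (g j / INR j) = 0%R ->
  (0 < D)%R -> (forall e, e \in maj -> coprime e.1.1 12 /\ 0 < e.1.2 /\ x %/ e.1.2 <= 12 ^ s) ->
  (forall b y, b < 12 -> coprime b 12 -> 0 < y ->
    (wsum js g b y <= INR (b == 1)%N
      + \rsum_(e <- maj | (e.1.1 == b) && (e.1.2 <= y)%N) (INR e.2 / D))%R) ->
  ((- INR x * \rsum_(j <- js) (g j * L j / INR j)
   - (\rsum_(j <- js) Rabs (g j)) * (12 * L x + 1)) / 12
   - \rsum_(e <- maj) (INR e.2 / D * (kappa 12 * ((INR x / INR e.1.2 + INR s * 12) / 11)))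
   <= psi (fun d => d == a %[mod 12]) x)%R.
Proof.
move=> jb jc ca g0 D0 Hmaj H.
have lo := lower_log_sum jb jc ca g0.
rewrite (weighted_log_identity _ (fun n => n == a %[mod 12])) in lo; last first.
  by move=> j /jb /andP[].
have k0 : (0 <= kappa 12)%R.
  rewrite /kappa; have := L_ge0 12; have -> : primes 12 = [:: 2; 3] by [].
  rewrite !big_cons big_nil; have := L_ge0 2; have := L_ge0 3 => /=; lra.
suff : (\rsum_(d <- upto x) (lam d * \rsum_(m <- upto (x %/ d) | (d * m)%N == a %[mod 12]) wconv js g m)
  <= psi (fun d => d == a %[mod 12]) x +
    \rsum_(e <- maj) (INR e.2 / D * (kappa 12 * ((INR x / INR e.1.2 + INR s * 12) / 11))))%R by lra.
apply: (@Rle_trans _ (\rsum_(d <- upto x) (lam d * (INR (d == a %[mod 12]) +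
   \rsum_(e <- maj | (d == (a * e.1.1)%N %[mod 12]) && (e.1.2 <= x %/ d)%N) (INR e.2 / D))))).
  apply: rsum_le => d; rewrite mem_index_iota => /andP[d0 dx] _.
  apply: Rmult_le_compat_l; first exact: lam_ge0.
  have [cd|ncd] := boolP (coprime d 12); last first.
    rewrite big1; last first.
      move=> m /eqP e; exfalso; move: ncd; suff : coprime (d * m) 12 by rewrite coprimeMl => /andP[->].
      by rewrite -coprime_modl e coprime_modl.
    apply: Rplus_le_le_0_compat; first exact: pos_INR.
    apply: rsum_ge0 => e _ _; apply: Rmult_le_pos; [exact: pos_INR|left; exact: Rinv_0_lt_compat].
  rewrite (eq_bigl (fun m => m == (d * a) %% 12 %[mod 12])); last first.
    by move=> m; rewrite unit12_mod_swap // modn_mod.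
  have cb : coprime ((d * a) %% 12) 12 by rewrite coprime_modl coprimeMl cd.
  have b12 : (d * a) %% 12 < 12 by rewrite ltn_mod.
  have y0 : 0 < x %/ d by rewrite divn_gt0 //; lia.
  apply: Rle_trans (H _ _ b12 cb y0) _; apply: Rplus_le_compat.
    right; congr (INR (nat_of_bool _)).
    have -> : ((d * a) %% 12 == 1) = (d * a == 1 %[mod 12]) by rewrite [1 %% 12]modn_small.
    by rewrite unit12_mod_swap // muln1 eq_sym.
  apply: rsum_sub => [e eM /andP[/eqP eb ->]|e _ _ _]; last first.
    by apply: Rmult_le_pos; [exact: pos_INR|left; exact: Rinv_0_lt_compat].
  by rewrite andbT eb eq_sym unit12_mod_swap // modn_mod mulnC.
under eq_bigr => d _ do rewrite Rmult_plus_distr_l.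
rewrite big_split /=; apply: Rplus_le_compat.
  right; rewrite /psi [RHS]big_mkcond; apply: eq_bigr => d _.
  by case: (_ == _) => /=; lra.
under eq_bigr => d _ do rewrite big_distrr /=.
rewrite (exchange_big_dep predT) //=.
apply: rsum_le => -[[b v] w] eM _ /=; have [/= cb [v0 vs]] := Hmaj _ eM.
have w0 : (0 <= INR w / D)%R by apply: Rmult_le_pos; [exact: pos_INR|left; exact: Rinv_0_lt_compat].
rewrite -big_distrl /= Rmult_comm; apply: Rmult_le_compat_l => //.
have cab : coprime (a * b) 12 by rewrite coprimeMl ca.
have [c12 cc] := unit12_mod cab.
apply: (@Rle_trans _ (psi (fun d => d == (a * b) %% 12 %[mod 12]) (x %/ v))).
  rewrite (@rsum_widen (x %/ v) x) ?leq_div //; last first.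
    move=> i /andP[iv ix] /andP[_ vi]; exfalso; have i0 : 0 < i by lia.
    by move: iv vi; rewrite ltn_divLR // leq_divRL // mulnC; lia.
  apply: rsum_sub => [d _ /andP[/eqP -> _]|d _ _ _]; last exact: lam_ge0.
  by rewrite modn_mod.
apply: Rle_trans (psi_class_le _ c12 cc vs) _ => //.
apply: Rmult_le_compat_l => //.
have -> : (INR 12 = 12)%R by rewrite /=; lra.
by have := INR_divn_le x v; lra.
Qed.

(** * Primes congruent to n modulo a prime power *)

Lemma kappa_12 q e : prime q -> 4 < q -> 0 < e ->
  kappa (12 * q ^ e) = (L (12 * q ^ e) + L 2 + L 3 / 2 + L q / (INR q - 1))%R.
Proof.
move=> pq q4 e0; rewrite /kappa.
have -> : primes (12 * q ^ e) = [:: 2; 3; q].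
  apply: (@irr_sorted_eq _ ltn); [exact: ltn_trans|exact: ltnn|exact: sorted_primes| |].
    by rewrite /= ; lia.
  move=> p; rewrite primesM ?expn_gt0 ?(prime_gt0 pq) // primesX // (primes_prime pq).
  by rewrite (_ : primes 12 = [:: 2; 3]) // !inE orbA.
rewrite !big_cons big_nil /=; lra.
Qed.

(** For d <= n the last congruence says that m divides n - d, which makes the prime d useless. *)
Definition killed (n a m : nat) : pred nat :=
  fun d => [&& prime d, d == a %[mod 12] & d == n %[mod m]].

Lemma coprime12 q : prime q -> 4 < q -> coprime 12 q.
Proof.
move=> pq q4; rewrite (_ : 12 = 2 ^ 2 * 3) // coprimeMl coprimeXl ?prime_coprime // ?dvdn_prime2 //.
all: lia.
Qed.

(** When q | n the class is not one of units, so the progression bounds do not apply; but then q is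
    the only prime in it. *)
Lemma killed_dvd n a q e d : prime q -> 0 < e -> q %| n -> killed n a (q ^ e) d -> d = q.
Proof.
move=> pq e0 qn /and3P[pd _ /eqP dn]; apply/eqP; rewrite eq_sym -dvdn_prime2 //.
have qm : q %| q ^ e by rewrite dvdn_exp.
by rewrite /dvdn -(modn_dvdm d qm) dn modn_dvdm.
Qed.

Lemma psi_pred1 (P : pred nat) n q : (forall d, P d -> d = q) -> (psi P n <= lam q)%R.
Proof.
move=> Pq; apply: (@Rle_trans _ (psi (pred1 q) n)).
  by apply: psi_sub => d /Pq /eqP.
have [qn|qn] := boolP (q \in upto n).
  rewrite /psi big_mkcond (bigD1_seq q) ?iota_uniq //= eqxx big1 ?Rplus_0_r; first exact: Rle_refl.
  by move=> i /negbTE ->.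
rewrite /psi big_seq_cond big1; first exact: lam_ge0.
by move=> i /andP[i1 /eqP i2]; rewrite i2 (negbTE qn) in i1.
Qed.

Lemma killed_class n a q e : prime q -> 4 < q -> 0 < e -> coprime a 12 -> ~~ (q %| n) ->
  exists c, [/\ 0 < c <= 12 * q ^ e, coprime c (12 * q ^ e) &
    forall d, killed n a (q ^ e) d -> d == c %[mod 12 * q ^ e]].
Proof.
move=> pq q4 e0 ca qn; set m := q ^ e; set Q := 12 * m.
have cm : coprime 12 m by rewrite coprimeXr // coprime12.
have m0 : 0 < m by rewrite expn_gt0 prime_gt0.
have Q0 : 0 < Q by rewrite muln_gt0.
pose c := chinese 12 m a n.
have cc : coprime c Q.
  rewrite coprimeMr -coprime_modl chinese_modl // coprime_modl ca /=.
  rewrite -coprime_modl chinese_modr // coprime_modl.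
  by rewrite coprime_sym coprimeXl // prime_coprime.
exists (c %% Q); split.
- apply/andP; split; last by apply: ltnW; rewrite ltn_mod.
  rewrite lt0n; apply: contraL cc => /eqP c0.
  by rewrite -coprime_modl c0 /coprime gcd0n gtn_eqF // /Q; lia.
- by rewrite coprime_modl.
move=> d /and3P[_ da dn]; rewrite modn_mod chinese_remainder //.
by rewrite chinese_modl // chinese_modr // da dn.
Qed.

Lemma kappa_ge Q : (L Q <= kappa Q)%R.
Proof.
rewrite /kappa; set S := bigop _ _ _; suff : (0 <= S)%R by lra.
apply: rsum_ge0 => p; rewrite mem_primes => /andP[/prime_gt1 pp _] _.
have := L_ge0 p; have : (2 <= INR p)%R by apply: (@INR_le 2).
by move=> *; apply: Rmult_le_pos => //; left; apply: Rinv_0_lt_compat; lra.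
Qed.

Lemma psi_killed_le n a q e s : prime q -> 4 < q -> 0 < e -> coprime a 12 ->
  0 < s -> n <= (12 * q ^ e) ^ s -> let Q := 12 * q ^ e in
  (psi (killed n a (q ^ e)) n <= kappa Q * ((INR n + INR s * INR Q) / (INR Q - 1)))%R.
Proof.
move=> pq q4 e0 ca s0 ns Q.
have qQ : q <= Q by rewrite /Q; case: (e) e0 => // k _; rewrite expnS; nia.
have [qn|qn] := boolP (q %| n); last first.
  have [c [cQ cc H]] := killed_class pq q4 e0 ca qn.
  apply: Rle_trans (psi_sub n H) _; apply: psi_class_le => //; lia.
apply: Rle_trans (psi_pred1 n (fun d => killed_dvd pq e0 qn)) _.
rewrite lam_prime //.
have Q2 : (2 <= INR Q)%R by apply: (@INR_le 2); lia.
(* Only the prime q is left: log q <= log Q <= [kappa Q], and the fraction is at least 1 because s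
   >= 1. *)
apply: (@Rle_trans _ (kappa Q * 1)).
  rewrite Rmult_1_r; apply: Rle_trans (kappa_ge Q); apply: L_le => //; lia.
apply: Rmult_le_compat_l; first by apply: Rle_trans (kappa_ge Q); apply: L_ge0.
have s1 : (1 <= INR s)%R by apply: (@INR_le 1).
apply: (Rmult_le_reg_r (INR Q - 1)); first by lra.
rewrite /Rdiv Rmult_assoc Rinv_l; last by lra.
have := pos_INR n; nra.
Qed.

(** A modulus exceeding n leaves at most one candidate up to n. This cheaper bound matters because
    it serves most of the squares r^2. *)
Lemma psi_killed_le_ln n a q e : prime q -> 4 < q -> 0 < e -> coprime a 12 ->
  n < 12 * q ^ e -> (psi (killed n a (q ^ e)) n <= L n)%R.
Proof.
move=> pq q4 e0 ca nQ.
have [z|n0] := posnP n; first by rewrite z /psi /index_iota /= big_nil; apply: L_ge0.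
have [c cQ H] : exists2 c, 0 < c & forall d, 0 < d <= n -> killed n a (q ^ e) d -> d = c.
  have [qn|qn] := boolP (q %| n).
    by exists q; [exact: prime_gt0|move=> d _; apply: killed_dvd].
  have [c [/andP[c0 cQ] cc H]] := killed_class pq q4 e0 ca qn.
  exists c => // d /andP[d0 dn] /H; have [->|cne] := eqVneq c (12 * q ^ e).
    by rewrite modnn modn_small; lia.
  by rewrite !modn_small; lia.
have [cn|nc] := leqP c n.
  apply: (@Rle_trans _ (psi (pred1 c) n)).
    apply: rsum_sub => [d|d _ _ _]; last exact: lam_ge0.
    by rewrite mem_index_iota ltnS => dn /(H _ dn) /eqP.
  apply: Rle_trans (_ : (lam c <= _)%R); first by apply: psi_pred1 => d /eqP.
  by apply: Rle_trans (lam_le cQ) _; apply: L_le.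
rewrite /psi big_seq_cond big1; first exact: L_ge0.
by move=> i /andP[]; rewrite mem_index_iota ltnS => iN /(H _ iN); lia.
Qed.

(** * An explicit choice of weights *)

(* Found by numerical optimization, in units of 1/20. The weight of 151, about
   -66.51 units, is not listed: it is the one that makes sum g_j / j vanish. *)
Definition weight_table : seq (nat * Z) := zip
  [:: 1; 5; 7; 11; 13; 17; 19; 23; 29; 31; 35; 37;
      41; 43; 47; 53; 55; 59; 61; 67; 71; 73; 79; 83;
      89; 109; 113; 127; 131; 137; 139; 143; 145; 149]
  [:: 20; -20; -20; -20; -20; -20; -20; -20; -20; -20; 8; -20;
      -20; -20; -8; -20; 3; -20; -20; -3; -20; -20; -20; -20;
      -11; -20; -9; -1; -37; -20; -20; -22; -20; -20]%Z.

Definition js0 : seq nat := map fst weight_table.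
Definition js : seq nat := rcons js0 151.

(* The default value -66 is an upper bound for the weight of 151. *)
Fixpoint lookup (t : seq (nat * Z)) (j : nat) : Z :=
  if t is (i, z) :: t' then if i == j then z else lookup t' j else (-66)%Z.

Definition zcoef (j : nat) : Z := lookup weight_table j.

Definition c151 : R := (- 151 * \rsum_(j <- js0) (IZR (zcoef j) / 20 / INR j))%R.

Definition wt (j : nat) : R := if j == 151 then c151 else (IZR (zcoef j) / 20)%R.

(* Upper bounds for the partial sums [wsum js wt b]: an entry (b, v, w) is a step of
   height w/20 at v. Beyond 4000 the bound is the maximal fluctuation of the
   number of multiples of j in a class modulo 12, see [tail_term]. *)
Definition majorant : seq (nat * nat * nat) :=
  [:: (1, 373, 20); (1, 409, 11); (1, 421, 20); (1, 433, 20); (1, 457, 9); (1, 2617, 1);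
      (1, 3889, 3); (1, 4000, 258);
      (5, 269, 8); (5, 281, 20); (5, 293, 20); (5, 821, 20); (5, 977, 15); (5, 2393, 16);
      (5, 4000, 253);
      (7, 223, 1); (7, 379, 12); (7, 643, 8); (7, 919, 13); (7, 1483, 11); (7, 1759, 16);
      (7, 3331, 11); (7, 3343, 20); (7, 4000, 226);
      (11, 263, 1); (11, 479, 8); (11, 491, 20); (11, 503, 20); (11, 2111, 3);
      (11, 4000, 256)].

Definition int_wconv (tbl : seq (N * Z)) (m : N) : Z :=
  foldr (fun p acc => if (m mod p.1 =? 0)%num then (p.2 + acc)%Z else acc) 0%Z tbl.

Definition steps (mj : seq (N * Z)) (m : N) : Z :=
  foldr (fun p acc => if (p.1 <=? m)%num then (p.2 + acc)%Z else acc) 0%Z mj.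

(** Runs through m, m + 12, ... in units of 1/20; [acc] is the partial sum so far, and [base] the 20
    units of the indicator when b = 1. Only binary integers occur, so that the virtual machine can
    evaluate it. *)
Fixpoint check (tbl mj : seq (N * Z)) (base : Z) (n : nat) (m : N) (acc : Z) : bool :=
  if n is n'.+1 then
    let acc' := (acc + int_wconv tbl m)%Z in
    if (acc' <=? base + steps mj m)%Z then check tbl mj base n' (m + 12)%num acc' else false
  else true.

Definition ntable : seq (N * Z) := [seq (N.of_nat j, zcoef j) | j <- js].
Definition nmaj (b : nat) : seq (N * Z) :=
  [seq (N.of_nat e.1.2, Z.of_nat e.2) | e <- majorant & e.1.1 == b].

(** 334 terms end at b + 3996, so every m < 4000 of the class is covered. *)
Lemma check_class b : b \in [:: 1; 5; 7; 11] ->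
  check ntable (nmaj b) (if b == 1 then 20%Z else 0%Z) 334 (N.of_nat b) 0%Z.
Proof. by rewrite !inE => /or4P[] /eqP ->; vm_compute. Qed.

(** In units of 1/240. The number of multiples of j in the class deviates from y / (12 j) by at
    least -c/12 and at most (12-c)/12; the sign of the weight decides which end is worse. The
    absolute weight of 151 lies between 66 and 67 units, whence the extra 1. *)
Definition tail_term (b j : nat) : Z :=
  let c := Z.of_nat ((j * b) %% 12) in
  if (0 <=? zcoef j)%Z then (zcoef j * (12 - c))%Z
  else ((- zcoef j + (if (j == 151)%N then 1 else 0)) * c)%Z.

Definition tail_bound (b : nat) : Z := foldr (fun j acc => (acc + tail_term b j)%Z) 0%Z js.

Lemma tail_bounds : all (fun b => (tail_bound b <=? 12 * ((if b == 1%N then 20 else 0) +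
  foldr (fun e s => Z.of_nat e.2 + s) 0 [seq e <- majorant | e.1.1 == b]))%Z) [:: 1; 5; 7; 11].
Proof. by vm_compute. Qed.

Lemma INR_Z n z : Z.of_nat n = z -> INR n = IZR z.
Proof. by move=> <-; apply: INR_IZR_INZ. Qed.

Definition sumdiv (l : seq nat) (F : nat -> Z) : Z :=
  foldr (fun j acc => (F j / Z.of_nat j + acc)%Z) 0%Z l.

(** Reduces a real sum to integer arithmetic: rounding each quotient down loses at most one unit,
    which is negligible once F carries a large scale factor. *)
Lemma sumdiv_bounds l F : all (leq 1) l ->
  (IZR (sumdiv l F) <= \rsum_(j <- l) (IZR (F j) / INR j)
   <= IZR (sumdiv l F) + INR (size l))%R.
Proof.
elim: l => [|j l IH] /=; first by rewrite big_nil; lra.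
move=> /andP[j0 /IH [lo hi]]; rewrite big_cons plus_IZR.
have j0' := INR0lt j0.
have e : IZR (F j) = (INR j * IZR (F j / Z.of_nat j) + IZR (F j mod Z.of_nat j))%R.
  by rewrite [INR j]INR_IZR_INZ -mult_IZR -plus_IZR -Z_div_mod_eq_full.
have [r0 r1] : (0 <= IZR (F j mod Z.of_nat j) <= INR j)%R.
  have := Z.mod_pos_bound (F j) (Z.of_nat j); rewrite INR_IZR_INZ => h.
  by split; apply: IZR_le; lia.
set q := IZR (_ / _) in e *; set r := IZR (_ mod _) in e r0 r1.
have -> : (IZR (F j) / INR j = q + r / INR j)%R by rewrite e; field; lra.
have : (0 <= r / INR j <= 1)%R.
  split; first by apply: Rmult_le_pos => //; left; apply: Rinv_0_lt_compat.
  by apply: (Rmult_le_reg_r (INR j)) => //; rewrite /Rdiv Rmult_assoc Rinv_l; lra.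
case: (l) lo hi => [|? ?]; rewrite ?S_INR /=; lra.
Qed.

Lemma c151_bounds : (- 67 / 20 <= c151 <= - 66 / 20)%R.
Proof.
have [] := @sumdiv_bounds js0 (fun j => 1000000 * zcoef j)%Z isT.
have -> : \rsum_(j <- js0) (IZR (1000000 * zcoef j) / INR j) =
          (20000000 * \rsum_(j <- js0) (IZR (zcoef j) / 20 / INR j))%R.
  rewrite big_distrr; apply: eq_bigr => j _; rewrite mult_IZR /Rdiv /=; lra.
have -> : sumdiv js0 (fun j => 1000000 * zcoef j)%Z = 440457%Z by vm_compute.
have -> : INR (size js0) = 34%R by rewrite INR_IZR_INZ.
rewrite /c151; set S := bigop _ _ _; lra.
Qed.

Lemma sum_wt_eq0 : \rsum_(j <- js) (wt j / INR j) = 0%R.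
Proof.
rewrite /js -cats1 big_cat big_seq1 {2}/wt eqxx (INR_Z (erefl : Z.of_nat 151 = 151%Z)) /c151.
set S := bigop _ _ _; set T := bigop _ _ _; suff -> : S = T.
  by change (T + -151 * T / 151 = 0)%R; field.
apply: eq_big_seq => j jj; rewrite /wt ifN //.
by apply: contraTneq jj => ->.
Qed.

Lemma js_props j : j \in js -> [/\ 0 < j, j <= 151 & coprime j 12].
Proof.
have : all (fun j => [&& 0 < j, j <= 151 & coprime j 12]) js by [].
by move=> /allP H /H /and3P[].
Qed.

Lemma wt_le j : (wt j <= IZR (zcoef j) / 20)%R.
Proof.
rewrite /wt; case: eqP => [->|_]; last by right.
have -> : zcoef 151 = (-66)%Z by [].
have := c151_bounds; lra.
Qed.

Lemma wt_ge j : (IZR (zcoef j - (if (j == 151)%N then 1 else 0)%Z) / 20 <= wt j)%R.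
Proof.
rewrite /wt; case: eqP => [->|_]; last by rewrite Z.sub_0_r; right.
have -> : (zcoef 151 - 1 = -67)%Z by [].
have := c151_bounds; lra.
Qed.

Lemma N_of_modn m j : N.of_nat (m %% j) = (N.of_nat m mod N.of_nat j)%num.
Proof.
case: j => [|j]; first by rewrite modn0 N.mod_0_r.
apply: (N.mod_unique _ _ (N.of_nat (m %/ j.+1))); first by have := ltn_pmod m (ltn0Sn j); lia.
by rewrite {1}(divn_eq m j.+1); lia.
Qed.

Lemma wconv_le_int m : (wconv js wt m <= IZR (int_wconv ntable (N.of_nat m)) / 20)%R.
Proof.
rewrite /wconv /ntable; elim: js => [|j l IH]; first by rewrite big_nil /=; lra.
rewrite big_cons /=.
have -> : (N.of_nat m mod N.of_nat j =? 0)%num = (j %| m).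
  by rewrite -N_of_modn /dvdn; apply/N.eqb_spec/eqP; lia.
case: ifP => _ //; rewrite plus_IZR; have := wt_le j; lra.
Qed.

Lemma steps_majorant b m :
  (IZR (steps (nmaj b) (N.of_nat m)) / 20)%R =
  \rsum_(e <- majorant | (e.1.1 == b) && (e.1.2 <= m)%N) (INR e.2 / 20).
Proof.
rewrite -big_filter_cond /nmaj; elim: [seq e <- _ | _] => [|e l IH].
  by rewrite big_nil /=; lra.
rewrite big_cons /= -IH INR_IZR_INZ.
have -> : (N.of_nat e.1.2 <=? N.of_nat m)%num = (e.1.2 <= m) by apply/N.leb_spec0/idP; lia.
by case: ifP => _ //; rewrite plus_IZR /Rdiv Rmult_plus_distr_r.
Qed.

Lemma checkS tbl mj base n m acc : check tbl mj base n.+1 m acc =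
  let acc' := (acc + int_wconv tbl m)%Z in
  if (acc' <=? base + steps mj m)%Z then check tbl mj base n (m + 12)%num acc' else false.
Proof. by []. Qed.

Lemma checkP mj base n m acc : check ntable mj base n (N.of_nat m) acc ->
  forall k, k < n ->
  (IZR acc / 20 + \rsum_(i <- iota 0 k.+1) wconv js wt (m + i * 12)%N
   <= IZR (base + steps mj (N.of_nat (m + k * 12))) / 20)%R.
Proof.
elim: n m acc => [|n IH] m acc //.
rewrite checkS; set acc' := (acc + _)%Z; cbv zeta.
case: Z.leb_spec0 => // /IZR_le le1.
have -> : (N.of_nat m + 12)%num = N.of_nat (m + 12) by lia.
move=> /IH{}IH k kn.
have h : (IZR acc / 20 + wconv js wt m <= IZR acc' / 20)%R.
  by have := wconv_le_int m; rewrite /acc' plus_IZR; lra.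
case: k kn => [|k] kn; first by rewrite /= big_cons big_nil mul0n addn0; lra.
have {IH} := IH k kn.
have -> : iota 0 k.+2 = 0 :: map (addn 1) (iota 0 k.+1) by rewrite -iotaDl.
rewrite big_cons big_map mul0n addn0.
rewrite [X in (_ + X <= _)%R](eq_bigr (fun i => wconv js wt (m + (1 + i) * 12)%N)); last first.
  by move=> i _; congr wconv; lia.
have -> : m + 12 + k * 12 = m + k.+1 * 12 by lia.
set S := bigop _ _ _; lra.
Qed.

Lemma class_base b : IZR (if b == 1 then 20%Z else 0%Z) = (20 * INR (b == 1)%N)%R.
Proof. by case: (b == 1); rewrite /= ?Rmult_1_r ?Rmult_0_r. Qed.

Lemma wsum_small b y : b \in [:: 1; 5; 7; 11] -> y < 4000 ->
  (wsum js wt b y <= INR (b == 1)%N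
      + \rsum_(e <- majorant | (e.1.1 == b) && (e.1.2 <= y)%N) (INR e.2 / 20))%R.
Proof.
move=> bb y4; have chk := check_class bb.
have b12 : 0 < b <= 12 by move: bb; rewrite !inE => /or4P[] /eqP ->.
rewrite /wsum -big_filter filter_progression // big_map -steps_majorant.
have le1 := leq_divM (y + 12 - b) 12.
have lt1 : (y + 12 - b) %/ 12 < 335 by rewrite ltn_divLR //; lia.
move: ((y + 12 - b) %/ 12) le1 lt1 => K.
case: K => [|k] le1 lt1.
  rewrite big_nil; have := pos_INR (b == 1)%N.
  have : (0 <= IZR (steps (nmaj b) (N.of_nat y)) / 20)%R; last by lra.
  rewrite steps_majorant; apply: rsum_ge0 => e _ _.
  by apply: Rmult_le_pos; [exact: pos_INR|lra].
have yk : b + k * 12 <= y by lia.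
have kn : k < 334 by lia.
have := @checkP (nmaj b) (if b == 1 then 20%Z else 0%Z) 334 b 0%Z chk k kn.
rewrite plus_IZR.
rewrite class_base.
rewrite Rdiv_plus_distr steps_majorant.
have : (\rsum_(e <- majorant | (e.1.1 == b) && (e.1.2 <= b + k * 12)%N) (INR e.2 / 20) <=
  \rsum_(e <- majorant | (e.1.1 == b) && (e.1.2 <= y)%N) (INR e.2 / 20))%R.
  apply: rsum_sub => [e _ /andP[-> h]|e _ _ _]; first by apply: leq_trans yk.
  by apply: Rmult_le_pos; [exact: pos_INR|lra].
rewrite -!steps_majorant; set S := bigop _ _ _; lra.
Qed.

(** The multiples are j k with k = j b modulo 12, so their number is (Y + 12 - c) / 12 rounded down,
    with Y the integer part of y / j. The outer rounding loses at most 11/12 and the inner one less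
    than 1/12, hence less than 1 together. *)
Lemma count_class_multiples j b y : 0 < j -> coprime j 12 -> coprime b 12 ->
  let c := INR ((j * b) %% 12) in
  (INR y / INR j / 12 - c / 12
   <= INR (count (fun m => (m == b %[mod 12]) && (j %| m)) (upto y))
   <= INR y / INR j / 12 + (12 - c) / 12)%R.
Proof.
move=> j0 cj cb c; have cjb : coprime (j * b) 12 by rewrite coprimeMl cj.
have [c12 _] := unit12_mod cjb.
have -> : count (fun m => (m == b %[mod 12]) && (j %| m)) (upto y) =
   (y %/ j + 12 - (j * b) %% 12) %/ 12.
  rewrite -size_filter.
  have -> : [seq m <- upto y | (m == b %[mod 12]) && (j %| m)] =
    [seq m <- [seq m <- upto y | j %| m] | m == b %[mod 12]] by rewrite -filter_predI.
  rewrite filter_multiples // filter_map size_map.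
  rewrite (eq_filter (a2 := fun k => k == (j * b) %% 12 %[mod 12])); last first.
    by move=> k /=; rewrite unit12_mod_swap // modn_mod.
  by rewrite filter_progression // size_map size_iota.
have j0' := INR0lt j0.
have E := divn_eq (y %/ j + 12 - (j * b) %% 12) 12.
have r12 := ltn_pmod (y %/ j + 12 - (j * b) %% 12) (isT : 0 < 12).
move: ((y %/ j + 12 - _) %/ 12) ((y %/ j + 12 - _) %% 12) E r12 => k r E r12.
have e1 := divn_eq y j; have r1 := ltn_pmod y j0.
have up := INR_divn_le y j.
have lo : (INR y / INR j <= INR (y %/ j) + 1)%R.
  apply: (Rmult_le_reg_r (INR j)) => //; rewrite /Rdiv Rmult_assoc Rinv_l; last by lra.
  rewrite Rmult_1_r -S_INR -mult_INR; apply: INR_le.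
  have h : y < (y %/ j).+1 * j by rewrite -ltn_divLR.
  exact: ltnW h.
have E2 : y %/ j + 12 = k * 12 + r + (j * b) %% 12.
  have H Y C : Y + 12 - C = k * 12 + r -> 0 < C <= 12 -> Y + 12 = k * 12 + r + C by lia.
  exact: H E c12.
have {}E2 : (INR (y %/ j) + 12 = INR k * 12 + INR r + c)%R.
  have := congr1 INR E2; rewrite !plus_INR mult_INR -/c.
  by have -> : INR 12 = 12%R by rewrite /=; lra.
have r0 := pos_INR r; have r11 : (INR r <= 11)%R.
  by have := @INR_le r 11 r12; have -> : INR 11 = 11%R by rewrite /=; lra.
split; lra.
Qed.

Lemma wsum_large b y : b \in [:: 1; 5; 7; 11] -> 4000 <= y ->
  (wsum js wt b y <= INR (b == 1)%N
      + \rsum_(e <- majorant | (e.1.1 == b) && (e.1.2 <= y)%N) (INR e.2 / 20))%R.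
Proof.
move=> bb y4.
have cb : coprime b 12 by move: bb; rewrite !inE => /or4P[] /eqP ->.
apply: (@Rle_trans _ (IZR (tail_bound b) / 240)); last first.
  move/allP/(_ b bb)/Z.leb_spec0/IZR_le: tail_bounds.
  rewrite mult_IZR plus_IZR.
  rewrite class_base.
  have -> : IZR (foldr (fun e s => (Z.of_nat e.2 + s)%Z) 0%Z [seq e <- majorant | e.1.1 == b]) =
     (20 * \rsum_(e <- majorant | (e.1.1 == b) && (e.1.2 <= y)%N) (INR e.2 / 20))%R; last by lra.
  have vy : all (fun e => e.1.2 <= 4000) majorant by [].
  rewrite -big_filter; have -> : [seq e <- majorant | (e.1.1 == b) && (e.1.2 <= y)] =
      [seq e <- majorant | e.1.1 == b].
    apply: eq_in_filter => e /(allP vy) ev /=; have -> : e.1.2 <= y by apply: leq_trans y4.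
    by rewrite andbT.
  elim: [seq e <- _ | _] => [|e l IH]; first by rewrite big_nil /=; lra.
  by rewrite big_cons /= plus_IZR IH INR_IZR_INZ; lra.
have -> : wsum js wt b y = \rsum_(j <- js)
    (wt j * INR (count (fun m => (m == b %[mod 12]) && (j %| m)) (upto y))).
  rewrite /wsum /wconv (exchange_big_dep predT) //=; apply: eq_bigr => j _.
  by rewrite rsum_const Rmult_comm.
have tE : IZR (tail_bound b) = \rsum_(j <- js) IZR (tail_term b j).
  rewrite /tail_bound; elim: js => [|j l IH]; first by rewrite big_nil.
  by rewrite big_cons /= plus_IZR IH Rplus_comm.
(* The linear main terms cancel, so the sum stays bounded for all y. *)
have main : (\rsum_(j <- js) (INR y / 12 * (wt j / INR j)) = 0)%R.
  by rewrite -big_distrr /= sum_wt_eq0 Rmult_0_r.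
rewrite tE [X in (_ <= X)%R]big_distrl.
apply: (Rle_trans _ _ _ _ (Req_le _ _ (Rplus_0_l _))).
rewrite -[X in (_ <= X + _)%R]main -big_split /= /Rdiv.
apply: rsum_le => j jj _; have [j0 j151 cj] := js_props jj.
have [lo hi] := count_class_multiples y j0 cj cb.
move: (count _ _) lo hi => C; set c := (j * b) %% 12 => lo hi.
have c0 := pos_INR c; have c12 : (INR c <= 12)%R.
  have := @INR_le c 12 (ltnW (ltn_pmod (j * b) (isT : 0 < 12))).
  by have -> : INR 12 = 12%R by rewrite /=; lra.
have := wt_le j; have := wt_ge j; rewrite minus_IZR => wl wu.
have -> : (INR y * / 12 * (wt j * / INR j) = wt j * (INR y / INR j / 12))%R.
  by field; have := INR0lt j0; lra.
move: lo hi; set Y := (INR y / INR j / 12)%R => lo hi.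
rewrite /tail_term -/c.
case: Z.leb_spec0 => [/IZR_le z0|/Z.nle_gt z0].
  rewrite mult_IZR minus_IZR -INR_IZR_INZ.
  have [jE|jne] := eqVneq j 151; first by move: z0; rewrite jE; have -> : zcoef 151 = (-66)%Z by []; lra.
  have e : wt j = (IZR (zcoef j) / 20)%R by rewrite /wt (negbTE jne).
  have : (wt j * INR C <= wt j * (Y + (12 - INR c) / 12))%R.
    by apply: Rmult_le_compat_l => //; rewrite e; lra.
  rewrite {4}e; nra.
have {}z0 : (IZR (zcoef j) <= -1)%R by apply: IZR_le; lia.
rewrite mult_IZR plus_IZR opp_IZR -INR_IZR_INZ.
have w0 : (wt j <= 0)%R by lra.
have h1 : (wt j * INR C <= wt j * (Y - INR c / 12))%R by nra.
set t := IZR (if _ then _ else _) in wl *.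
have h2 : (- wt j * INR c <= (- IZR (zcoef j) + t) / 20 * INR c)%R.
  by apply: Rmult_le_compat_r => //; lra.
lra.
Qed.

Lemma wsum_bound b y : b < 12 -> coprime b 12 -> 0 < y ->
  (wsum js wt b y <= INR (b == 1)%N
      + \rsum_(e <- majorant | (e.1.1 == b) && (e.1.2 <= y)%N) (INR e.2 / 20))%R.
Proof.
move=> b12 cb _; have bb : b \in [:: 1; 5; 7; 11] by move: b12 cb; do 12 case: b => [|b] //.
by case: (ltnP y 4000); [apply: wsum_small|apply: wsum_large].
Qed.

(** * Numerical logarithms *)

Section Atanh.
Local Open Scope R_scope.

Lemma derivative_ge0_le (f f' : R -> R) u : 0 <= u -> f 0 = 0 ->
  (forall t, 0 <= t <= u -> derivable_pt_lim f t (f' t)) ->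
  (forall t, 0 <= t <= u -> 0 <= f' t) -> 0 <= f u.
Proof.
move=> u0 f0 df f'0; case: (Rle_lt_or_eq_dec _ _ u0) => [u1|<-]; last by rewrite f0; lra.
have [c [e [c1 c2]]] := MVT_cor2 f f' 0 u u1 (fun c h => df c h).
have := f'0 c ltac:(lra); rewrite f0 in e; nra.
Qed.

Lemma derive_log_ratio t : -1 < t < 1 ->
  derivable_pt_lim (fun t => ln (1 + t) - ln (1 - t)) t (2 / (1 - t * t)).
Proof.
move=> [t0 t1].
have d1 : derivable_pt_lim (fun t => ln (1 + t)) t (/ (1 + t) * 1).
  apply: (derivable_pt_lim_comp (fun t => 1 + t) ln); last by apply: derivable_pt_lim_ln; lra.
  have -> : 1 = 0 + 1 by lra.
  apply: (derivable_pt_lim_plus (fun=> 0 + 1) id); last exact: derivable_pt_lim_id.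
  exact: derivable_pt_lim_const.
have d2 : derivable_pt_lim (fun t => ln (1 - t)) t (/ (1 - t) * -1).
  apply: (derivable_pt_lim_comp (fun t => 1 - t) ln); last by apply: derivable_pt_lim_ln; lra.
  have -> : -1 = 0 - 1 by lra.
  apply: (derivable_pt_lim_minus (fun=> 1) id); last exact: derivable_pt_lim_id.
  exact: derivable_pt_lim_const.
have -> : 2 / (1 - t * t) = / (1 + t) * 1 - / (1 - t) * -1 by field; nra.
exact: (derivable_pt_lim_minus _ _ _ _ _ d1 d2).
Qed.

Lemma derive_odd_quintic c t :
  derivable_pt_lim (fun t => 2 * t + (2 / 3) * t ^ 3 + (2 * c / 5) * t ^ 5) t
    (2 + 2 * t ^ 2 + 2 * c * t ^ 4).
Proof.
have D n k : derivable_pt_lim (fun t => k * t ^ n) t (k * (INR n * t ^ n.-1)).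
  exact: (derivable_pt_lim_scal (fun t => t ^ n) k t _ (derivable_pt_lim_pow t n)).
have D1 : derivable_pt_lim (fun t => 2 * t) t (2 * 1).
  exact: (derivable_pt_lim_scal id 2 t _ (derivable_pt_lim_id t)).
have -> : 2 + 2 * t ^ 2 + 2 * c * t ^ 4 =
  2 * 1 + 2 / 3 * (INR 3 * t ^ 3.-1) + 2 * c / 5 * (INR 5 * t ^ 5.-1) by rewrite /=; field.
exact: (derivable_pt_lim_plus _ _ _ _ _ (derivable_pt_lim_plus _ _ _ _ _ D1 (D 3%N (2 / 3)))
          (D 5%N (2 * c / 5))).
Qed.

Lemma log_ratio_ge u : 0 <= u < 1 ->
  2 * u + (2 / 3) * u ^ 3 + (2 * 1 / 5) * u ^ 5 <= ln (1 + u) - ln (1 - u).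
Proof.
move=> [u0 u1].
have := @derivative_ge0_le
  (fun t => (ln (1 + t) - ln (1 - t)) - (2 * t + (2 / 3) * t ^ 3 + (2 * 1 / 5) * t ^ 5))
  (fun t => 2 / (1 - t * t) - (2 + 2 * t ^ 2 + 2 * 1 * t ^ 4)) u u0.
have -> : ln (1 + 0) - ln (1 - 0) - (2 * 0 + 2 / 3 * 0 ^ 3 + 2 * 1 / 5 * 0 ^ 5) = 0.
  by rewrite Rplus_0_r Rminus_0_r; field.
move=> /(_ erefl) H; suff : 0 <= ln (1 + u) - ln (1 - u) - (2 * u + 2 / 3 * u ^ 3 + 2 * 1 / 5 * u ^ 5) by lra.
apply: H => t tu.
  apply: (derivable_pt_lim_minus _ _ _ _ _ (derive_log_ratio _) (derive_odd_quintic 1 t)); lra.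
have t2 : 0 < 1 - t * t by nra.
have -> : 2 / (1 - t * t) - (2 + 2 * t ^ 2 + 2 * 1 * t ^ 4) = 2 * t ^ 6 / (1 - t * t) by field; lra.
apply: Rmult_le_pos; last by left; apply: Rinv_0_lt_compat.
have : 0 <= t ^ 6 by apply: pow_le; lra.
lra.
Qed.

(** In the derivative 2 / (1 - t^2) the tail of the geometric series from t^4 on is 2 t^4 / (1 -
    t^2), at most 2 c t^4 with c taken at the endpoint u. *)
Lemma log_ratio_le u : 0 <= u < 1 ->
  ln (1 + u) - ln (1 - u) <= 2 * u + (2 / 3) * u ^ 3 + (2 * / (1 - u * u) / 5) * u ^ 5.
Proof.
move=> [u0 u1]; set c := / (1 - u * u).
have := @derivative_ge0_le
  (fun t => (2 * t + (2 / 3) * t ^ 3 + (2 * c / 5) * t ^ 5) - (ln (1 + t) - ln (1 - t)))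
  (fun t => (2 + 2 * t ^ 2 + 2 * c * t ^ 4) - 2 / (1 - t * t)) u u0.
have -> : 2 * 0 + 2 / 3 * 0 ^ 3 + 2 * c / 5 * 0 ^ 5 - (ln (1 + 0) - ln (1 - 0)) = 0.
  by rewrite Rplus_0_r Rminus_0_r; field.
move=> /(_ erefl) H; suff : 0 <= 2 * u + 2 / 3 * u ^ 3 + 2 * c / 5 * u ^ 5 - (ln (1 + u) - ln (1 - u)) by lra.
apply: H => t tu.
  apply: (derivable_pt_lim_minus _ _ _ _ _ (derive_odd_quintic c t) (derive_log_ratio _)); lra.
have t2 : 0 < 1 - t * t by nra.
have ct : / (1 - t * t) <= c.
  by apply: Rinv_le_contravar; [nra|nra].
have -> : (2 + 2 * t ^ 2 + 2 * c * t ^ 4) - 2 / (1 - t * t) = 2 * t ^ 4 * (c - / (1 - t * t)) by field; lra.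
apply: Rmult_le_pos; last by lra.
have : 0 <= t ^ 4 by apply: pow_le; lra.
lra.
Qed.

End Atanh.

(* log (n+1) - log n = 2 artanh (1/(2n+1)); the bounds truncate the odd power series. *)
Definition log_scale : Z := 100000000.

Fixpoint log_lo (n : nat) : Z :=
  if n is n'.+1 then
    if n' is 0 then 0%Z else
    let d := (2 * Z.of_nat n' + 1)%Z in
    (log_lo n' + log_scale * (30 * d ^ 4 + 10 * d ^ 2 + 6) / (15 * d ^ 5))%Z
  else 0%Z.

(** With u = 1/d one has 1 / (1 - u^2) = d^2 / e, so the quintic term of [log_ratio_le] becomes 2 /
    (5 d^3 e); the final 1 rounds upwards. *)
Fixpoint log_hi (n : nat) : Z :=
  if n is n'.+1 then
    if n' is 0 then 0%Z else
    let d := (2 * Z.of_nat n' + 1)%Z in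
    let e := (d ^ 2 - 1)%Z in
    (log_hi n' + (log_scale * (30 * d ^ 2 * e + 10 * e + 6) / (15 * d ^ 3 * e) + 1))%Z
  else 0%Z.

Lemma log_succ n : 0 < n -> let u := (/ (2 * INR n + 1))%R in
  (L n.+1 - L n = ln (1 + u) - ln (1 - u))%R /\ (0 <= u < 1)%R.
Proof.
move=> n0 u; have n1 : (1 <= INR n)%R by apply: (@INR_le 1).
have u0 : (0 < u)%R by apply: Rinv_0_lt_compat; lra.
have u1 : (u < 1)%R by rewrite -Rinv_1; apply: Rinv_lt_contravar; lra.
split; last lra.
have e1 : (1 + u = INR n.+1 * (2 * u))%R by rewrite S_INR /u; field; lra.
have e2 : (1 - u = INR n * (2 * u))%R by rewrite /u; field; lra.
rewrite e1 e2 !ln_mult /L; try lra; by apply: INR0lt.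
Qed.

Lemma IZR_div_le a b : (0 < b)%Z -> (IZR (a / b) <= IZR a / IZR b)%R.
Proof.
move=> b0; have b0' : (0 < IZR b)%R by apply: IZR_lt.
apply: (Rmult_le_reg_r (IZR b)) => //.
rewrite /Rdiv Rmult_assoc Rinv_l; last by lra.
by rewrite Rmult_1_r -mult_IZR; apply: IZR_le; have := Z.mul_div_le a b b0; lia.
Qed.

Lemma IZR_div_ge a b : (0 < b)%Z -> (IZR a / IZR b <= IZR (a / b + 1))%R.
Proof.
move=> b0; have b0' : (0 < IZR b)%R by apply: IZR_lt.
apply: (Rmult_le_reg_r (IZR b)) => //.
rewrite /Rdiv Rmult_assoc Rinv_l; last by lra.
by rewrite Rmult_1_r -mult_IZR; apply: IZR_le; have := Z.mul_succ_div_gt a b b0; lia.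
Qed.

Lemma IZR_pow d : (((IZR (d ^ 2) = IZR d ^ 2)%R * (IZR (d ^ 3) = IZR d ^ 3)%R) *
  ((IZR (d ^ 4) = IZR d ^ 4)%R * (IZR (d ^ 5) = IZR d ^ 5)%R))%type.
Proof.
by rewrite (pow_IZR d 2) (pow_IZR d 3) (pow_IZR d 4) (pow_IZR d 5).
Qed.

Lemma log_loP n : 0 < n -> (IZR (log_lo n) <= IZR log_scale * L n)%R.
Proof.
have S0 : (0 < IZR log_scale)%R by apply: IZR_lt.
case: n => // n _; elim: n => [|n IH]; first by rewrite L1 /= Rmult_0_r; apply: Rle_refl.
have [e u01] := log_succ (ltn0Sn n); have := log_ratio_ge u01; rewrite -e.
set m := n.+1 in IH e u01 *; have m1 : (1 <= INR m)%R by apply: (@INR_le 1).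
have -> : log_lo m.+1 = (log_lo m + log_scale * (30 * (2 * Z.of_nat m + 1) ^ 4 + 10 * (2 * Z.of_nat m + 1) ^ 2 + 6)
   / (15 * (2 * Z.of_nat m + 1) ^ 5))%Z by [].
set d := (2 * Z.of_nat m + 1)%Z.
have dE : IZR d = (2 * INR m + 1)%R by rewrite /d plus_IZR mult_IZR -INR_IZR_INZ.
rewrite -dE plus_IZR => h.
have d0 : (0 < d)%Z by rewrite /d; lia.
have d0' : (0 < IZR d)%R by apply: IZR_lt.
have := @IZR_div_le (log_scale * (30 * d ^ 4 + 10 * d ^ 2 + 6)) (15 * d ^ 5) ltac:(lia).
rewrite (mult_IZR log_scale) 2!plus_IZR (mult_IZR 30) (mult_IZR 10) (mult_IZR 15) !IZR_pow => h2.
have : (IZR log_scale * (2 * / IZR d + 2 / 3 * (/ IZR d) ^ 3 + 2 * 1 / 5 * (/ IZR d) ^ 5) <= IZR log_scale * (L m.+1 - L m))%R.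
  by apply: Rmult_le_compat_l; lra.
have <- : (IZR log_scale * (30 * IZR d ^ 4 + 10 * IZR d ^ 2 + 6) / (15 * IZR d ^ 5) =
  IZR log_scale * (2 * / IZR d + 2 / 3 * (/ IZR d) ^ 3 + 2 * 1 / 5 * (/ IZR d) ^ 5))%R by field; lra.
lra.
Qed.

Lemma log_hiP n : 0 < n -> (IZR log_scale * L n <= IZR (log_hi n))%R.
Proof.
have S0 : (0 < IZR log_scale)%R by apply: IZR_lt.
case: n => // n _; elim: n => [|n IH]; first by rewrite L1 /= Rmult_0_r; apply: Rle_refl.
have [e u01] := log_succ (ltn0Sn n); have := log_ratio_le u01; rewrite -e.
set m := n.+1 in IH e u01 *; have m1 : (1 <= INR m)%R by apply: (@INR_le 1).
have -> : log_hi m.+1 = (log_hi m + (log_scale * (30 * (2 * Z.of_nat m + 1) ^ 2 * ((2 * Z.of_nat m + 1) ^ 2 - 1)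
    + 10 * ((2 * Z.of_nat m + 1) ^ 2 - 1) + 6)
   / (15 * (2 * Z.of_nat m + 1) ^ 3 * ((2 * Z.of_nat m + 1) ^ 2 - 1)) + 1))%Z by [].
set d := (2 * Z.of_nat m + 1)%Z; set f := (d ^ 2 - 1)%Z.
have dE : IZR d = (2 * INR m + 1)%R by rewrite /d plus_IZR mult_IZR -INR_IZR_INZ.
rewrite -dE plus_IZR => h.
have d0 : (3 <= d)%Z by rewrite /d /m; lia.
have d0' : (3 <= IZR d)%R by apply: IZR_le.
have f0 : (0 < f)%Z by rewrite /f; nia.
have fE : IZR f = (IZR d ^ 2 - 1)%R by rewrite /f minus_IZR IZR_pow.
have f0' : (0 < IZR d ^ 2 - 1)%R by rewrite -fE; apply: IZR_lt.
have := @IZR_div_ge (log_scale * (30 * d ^ 2 * f + 10 * f + 6)) (15 * d ^ 3 * f) ltac:(nia).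
rewrite (mult_IZR log_scale) 2!plus_IZR !(mult_IZR _ f) (mult_IZR 30) (mult_IZR 15) !IZR_pow fE => h2.
have : (IZR log_scale * (L m.+1 - L m) <=
  IZR log_scale * (2 * / IZR d + 2 / 3 * (/ IZR d) ^ 3 + 2 * / (1 - / IZR d * / IZR d) / 5 * (/ IZR d) ^ 5))%R.
  by apply: Rmult_le_compat_l; lra.
have <- : (IZR log_scale * (30 * IZR d ^ 2 * (IZR d ^ 2 - 1) + 10 * (IZR d ^ 2 - 1) + 6) / (15 * IZR d ^ 3 * (IZR d ^ 2 - 1)) =
  IZR log_scale * (2 * / IZR d + 2 / 3 * (/ IZR d) ^ 3 + 2 * / (1 - / IZR d * / IZR d) / 5 * (/ IZR d) ^ 5))%R.
  by field; repeat split; nra.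
lra.
Qed.

(** * Lower bound for the primes in a class modulo 12 *)

(* [sum g_j / j = 0] removes the weight of 151 from [- sum g_j log j / j]. *)
Definition log_term (j : nat) : Z :=
  if (0 <=? zcoef j)%Z then (zcoef j * (log_lo 151 - log_hi j))%Z
  else (zcoef j * (log_hi 151 - log_lo j))%Z.

Lemma js_js0 j : j \in js0 -> j \in js /\ j != 151.
Proof.
move=> jj; rewrite /js mem_rcons inE jj orbT; split=> //.
by apply: contraTneq jj => ->.
Qed.

Lemma sum_wt_log : (2.853 <= - \rsum_(j <- js) (wt j * L j / INR j))%R.
Proof.
have -> : (- \rsum_(j <- js) (wt j * L j / INR j) =
  \rsum_(j <- js) (wt j * (L 151 - L j) / INR j))%R.
  transitivity (L 151 * \rsum_(j <- js) (wt j / INR j) +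
    - 1 * \rsum_(j <- js) (wt j * L j / INR j))%R; first by rewrite sum_wt_eq0; lra.
  rewrite !big_distrr -big_split /=; apply: eq_big_seq => j /js_props [j0 _ _].
  by have := INR0lt j0; move=> ?; field; lra.
rewrite {1}/js -cats1 big_cat big_seq1.
have -> : (wt 151 * (L 151 - L 151) / INR 151 = 0)%R by rewrite /Rdiv; ring.
rewrite [X in (_ <= X)%R]Rplus_0_r.
suff H : (2.853 <= \rsum_(j <- js0) (wt j * (L 151 - L j) / INR j))%R by exact: H.
have j1 : all (leq 1) js0 by [].
have [lo _] := sumdiv_bounds log_term j1.
have v : (5706000000 <= sumdiv js0 log_term)%Z by apply/Z.leb_spec0; vm_compute.
suff : (\rsum_(j <- js0) (IZR (log_term j) / INR j) <=
  (20 * 100000000) * \rsum_(j <- js0) (wt j * (L 151 - L j) / INR j))%R.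
  move/IZR_le: v; lra.
rewrite big_distrr /=; apply: rsum_le => j jj _.
have j0 : 0 < j by apply: (allP j1).
have [_ j151] := js_js0 jj; have j0' := INR0lt j0.
have -> : (20 * 100000000 * (wt j * (L 151 - L j) / INR j) =
  (IZR (zcoef j) * (100000000 * (L 151 - L j))) / INR j)%R.
  by rewrite /wt (negbTE j151); field; lra.
apply: Rmult_le_compat_r; first by left; apply: Rinv_0_lt_compat.
have := log_loP j0; have := log_hiP j0.
have := @log_loP 151 isT; have := @log_hiP 151 isT; rewrite /log_term /log_scale => a1 a2 a3 a4.
case: Z.leb_spec0 => [/IZR_le z0|/Z.nle_gt/IZR_lt z0].
all: by rewrite mult_IZR minus_IZR; nra.
Qed.

Lemma sum_abs_wt : (\rsum_(j <- js) Rabs (wt j) <= 33.5)%R.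
Proof.
apply: (Rle_trans _ (\rsum_(j <- js) (IZR (Z.abs (zcoef j) + Z.b2z (j == 151)%N) / 20))).
  apply: rsum_le => j _ _; have := wt_le j; have := wt_ge j.
  rewrite minus_IZR plus_IZR abs_IZR; case: eqP => h.
    rewrite h; have -> : zcoef 151 = (-66)%Z by [].
    move=> a b; rewrite (Rabs_left (wt 151)); last lra.
    by rewrite (Rabs_left (-66)); [rewrite (_ : Z.b2z true = 1%Z) //; lra|lra].
  move=> a b; have -> : wt j = (IZR (zcoef j) / 20)%R by lra.
  change (Z.b2z false) with 0%Z; rewrite /Rdiv Rabs_mult (Rabs_right (/ 20)); lra.
have H l : (\rsum_(j <- l) (IZR (Z.abs (zcoef j) + Z.b2z (j == 151)%N) / 20) =
  IZR (foldr (fun j s => Z.abs (zcoef j) + Z.b2z (j == 151)%N + s) 0 l)%Z / 20)%R.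
  elim: l => [|j l IH]; first by rewrite big_nil /=; lra.
  by rewrite big_cons IH /= !plus_IZR; lra.
rewrite H.
have -> : foldr (fun j s => Z.abs (zcoef j) + Z.b2z (j == 151)%N + s)%Z 0%Z js = 669%Z by vm_compute.
lra.
Qed.

Lemma kappa_12_le : (kappa 12 <= 3.728)%R.
Proof.
rewrite /kappa (_ : primes 12 = [:: 2; 3]) // !big_cons big_nil.
have -> : L 12 = (2 * L 2 + L 3)%R by rewrite -[12]/(2 * 2 * 3) !LM //; lra.
have := @log_hiP 2 isT; have := @log_hiP 3 isT; rewrite /log_scale.
have -> : log_hi 2 = 69320988%Z by vm_compute.
have -> : log_hi 3 = 109867655%Z by vm_compute.
rewrite /=; lra.
Qed.

Lemma majorant_sums :
  (\rsum_(e <- majorant) (INR e.2 / 20 / INR e.1.2) <= 0.0425)%R /\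
  \rsum_(e <- majorant) (INR e.2 / 20) = 66%R.
Proof.
split.
  pose F := foldr (fun (e : nat * nat * nat) s => (1000000 * Z.of_nat e.2 / Z.of_nat e.1.2 + 1 + s)%Z) 0%Z.
  have H (l : seq (nat * nat * nat)) : all (fun e => 0 < e.1.2) l ->
      (\rsum_(e <- l) (INR e.2 / 20 / INR e.1.2) <= IZR (F l) / 20000000)%R.
    elim: l => [|[[b v] w] l IH] /=; first by rewrite big_nil; lra.
    move=> /andP[/= v0 /IH{}IH]; rewrite big_cons /= plus_IZR.
    have := @IZR_div_ge (1000000 * Z.of_nat w) (Z.of_nat v) ltac:(lia).
    rewrite mult_IZR -!INR_IZR_INZ; have v0' := INR0lt v0.
    have -> : (INR w / 20 / INR v = 1000000 * INR w / INR v / 20000000)%R by field; lra.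
    set X := IZR (_ + 1)%Z; lra.
  apply: Rle_trans (H majorant isT) _; have -> : F majorant = 849851%Z by vm_compute.
  lra.
have H (l : seq (nat * nat * nat)) :
    \rsum_(e <- l) (INR e.2 / 20) = (IZR (foldr (fun e s => Z.of_nat e.2 + s)%Z 0%Z l) / 20)%R.
  elim: l => [|e l IH]; first by rewrite big_nil /=; lra.
  by rewrite big_cons IH /= plus_IZR INR_IZR_INZ; lra.
rewrite H; have -> : foldr (fun e s => Z.of_nat e.2 + s)%Z 0%Z majorant = 1320%Z by vm_compute.
lra.
Qed.

(** 0.22334 comes from 2.853 / 12 - 3.728 * 0.0425 / 11, and 268.5 from 3.728 * 12 * 66 / 11, where
    66 is the total height of the majorant. All its steps lie beyond 200, so n / 200 bounds every
    argument at which [psi_class_le] is applied. *)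
Lemma psi12_ge a n s : 151 <= n -> coprime a 12 -> n %/ 200 <= 12 ^ s ->
  (0.22334 * INR n - 33.5 * (L n + 1 / 12) - 268.5 * INR s
   <= psi (fun d => d == a %[mod 12]) n)%R.
Proof.
move=> n151 ca ns.
apply: Rle_trans; last apply: (@psi12_lower js wt majorant 20 a n s) => //; last first.
- exact: wsum_bound.
- move=> e eM; have : all (fun e => coprime e.1.1 12 && (200 <= e.1.2)) majorant by [].
  move=> /allP/(_ e eM)/andP[-> v200]; split=> //; split; first exact: leq_trans v200.
  by apply: leq_trans ns; apply: leq_div2l.
- lra.
- exact: sum_wt_eq0.
- by move=> j /js_props[].
- by move=> j /js_props[j0 jn _]; rewrite j0 (leq_trans jn).
have -> : \rsum_(e <- majorant) (INR e.2 / 20 *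
    (kappa 12 * ((INR n / INR e.1.2 + INR s * 12) / 11))) =
  (kappa 12 / 11 * (INR n * \rsum_(e <- majorant) (INR e.2 / 20 / INR e.1.2)
     + 12 * INR s * \rsum_(e <- majorant) (INR e.2 / 20)))%R.
  rewrite Rmult_plus_distr_l -!Rmult_assoc !big_distrr -big_split /=.
  by apply: eq_bigr => i _; rewrite /Rdiv; ring.
have [w1 ->] := majorant_sums; have k1 := kappa_12_le.
have k0 : (0 <= kappa 12)%R by apply: Rle_trans (kappa_ge 12); apply: L_ge0.
have mu := sum_wt_log; have G1 := sum_abs_wt.
have n0 := pos_INR n; have s0 := pos_INR s; have l0 := L_ge0 n.
move: mu G1 w1; set S1 := bigop _ _ _; set G := bigop _ _ _; set W := bigop _ _ _ => mu G1 w1.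
have W0 : (0 <= W)%R.
  apply: rsum_ge0 => e eM _; apply: Rmult_le_pos.
    by apply: Rmult_le_pos; [exact: pos_INR|lra].
  have : all (fun e => 0 < e.1.2) majorant by [].
  by move=> /allP/(_ e eM)/INR0lt v0; left; apply: Rinv_0_lt_compat.
have h1 : (INR n * 2.853 <= INR n * - S1)%R by apply: Rmult_le_compat_l.
have h2 : (G * (12 * L n + 1) <= 33.5 * (12 * L n + 1))%R by apply: Rmult_le_compat_r; lra.
have h3 : (kappa 12 * (INR n * W) <= 3.728 * (INR n * 0.0425))%R.
  by apply: Rmult_le_compat => //; [apply: Rmult_le_pos|apply: Rmult_le_compat_l].
have h4 : (kappa 12 * INR s <= 3.728 * INR s)%R by apply: Rmult_le_compat_r.
lra.
Qed.

(** * Counting excluded primes *)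

Lemma rsum_cover (I J : eqType) (r : seq I) (s : seq J) (P : pred I) (Q : J -> pred I)
    (F : I -> R) :
  (forall i, i \in r -> 0 <= F i)%R ->
  (forall i, i \in r -> P i -> F i <> 0%R -> exists2 j, j \in s & Q j i) ->
  (\rsum_(i <- r | P i) F i <= \rsum_(j <- s) \rsum_(i <- r | Q j i) F i)%R.
Proof.
move=> F0 H; rewrite (exchange_big_dep predT) //= big_mkcond.
apply: rsum_le => i ir _.
have S0 : (0 <= \rsum_(j <- s | Q j i) F i)%R by apply: rsum_ge0 => *; apply: F0.
case: ifP => // Pi; case: (Req_dec (F i) 0) => [->|Fi]; first by apply: rsum_ge0 => *; lra.
have [j js Qj] := H i ir Pi Fi; rewrite (big_rem j) //= Qj.
set T := bigop _ _ _; suff : (0 <= T)%R by lra.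
by apply: rsum_ge0 => *; apply: F0.
Qed.

Lemma rsum_uniq_sub (I : eqType) (s t : seq I) (F : I -> R) :
  uniq s -> {subset s <= t} -> (forall i, i \in t -> 0 <= F i)%R ->
  (\rsum_(i <- s) F i <= \rsum_(i <- t) F i)%R.
Proof.
elim: s t => [|x s IH] t /=; first by move=> _ _ F0; rewrite big_nil; apply: rsum_ge0 => *; apply: F0.
move=> /andP[xs us] st F0; have xt : x \in t by apply: st; rewrite inE eqxx.
rewrite big_cons (big_rem x xt) /=; apply: Rplus_le_compat_l; apply: IH => //.
  move=> y ys; have := st y; rewrite inE ys orbT => /(_ isT).
  rewrite (perm_mem (perm_to_rem xt)) inE => /orP[/eqP e|//].
  by rewrite e (negbTE xs) in ys.
by move=> i /mem_rem; apply: F0.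
Qed.

Lemma sum_lam_p_part_le p n : prime p -> (\rsum_(d <- upto n | p %| d) lam d <= L n)%R.
Proof.
move=> pp; have p0 := prime_gt0 pp; have p1 := prime_gt1 pp.
elim/ltn_ind: n => n IH.
rewrite (eq_bigl (fun d => (p %| d) && true)); last by move=> d; rewrite andbT.
rewrite rsum_multiples //.
have [np|np] := posnP (n %/ p).
  by rewrite np /index_iota /= big_nil; apply: L_ge0.
have n0 : 0 < n by case: (n) np => //; rewrite div0n.
have lt : n %/ p < n by rewrite ltn_Pdiv.
rewrite big_ltn // muln1 lam_prime //.
apply: (@Rle_trans _ (L p + L (n %/ p))); last first.
  by rewrite -LM //; apply: L_le; rewrite ?muln_gt0 ?p0 // mulnC leq_divM.
apply: Rplus_le_compat_l; apply: Rle_trans (IH _ lt).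
rewrite [X in (_ <= X)%R]big_ltn_cond // dvdn1 gtn_eqF // [X in (_ <= X)%R]big_mkcond /=.
apply: rsum_le => m; rewrite mem_index_iota => /andP[m1 _] _.
case: ifP => pm; first by rewrite lamM_prime //; [right|lia].
by rewrite lamM0 ?pm //; right.
Qed.

(** c = 1 gives the r whose square can divide some n - p; c = 12 those whose full modulus 12 r^2 is
    still at most n. *)
Definition primes_sqr (c n : nat) : seq nat :=
  [seq r <- upto n | [&& prime r, 4 < r & c * r ^ 2 <= n]].

Lemma primes_sqr_uniq c n : uniq (primes_sqr c n).
Proof. by rewrite filter_uniq ?iota_uniq. Qed.

Lemma mem_primes_sqr c n r : 0 < c ->
  (r \in primes_sqr c n) = [&& prime r, 4 < r & c * r ^ 2 <= n].
Proof.
move=> c0; rewrite mem_filter mem_index_iota; apply/andb_idr => /and3P[_ r4 h].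
by rewrite !ltnS; nia.
Qed.

(** Primes above 4 are 1 or 5 modulo 6. The number 1 lies in these classes without being prime, and
    discounting it absorbs the rounding. *)
Lemma count_large_primes y : 3 * count (fun r => prime r && (4 < r)) (upto y) <= y.
Proof.
set P := fun r => _.
have H : count P (upto y) + (0 < y) <=
    count (fun r => r == 1 %[mod 6]) (upto y) + count (fun r => r == 5 %[mod 6]) (upto y).
  rewrite -count_predUI; apply: leq_trans (leq_addr _ _); set U := predU _ _.
  case: y => [|y] //; rewrite /index_iota subn1 [y.+2.-1]/= [iota 1 y.+1]/=.
  have cE (A : pred nat) : count A (1 :: iota 2 y) = A 1 + count A (iota 2 y) by [].
  rewrite !cE (_ : P 1 = false) // (_ : U 1 = true) // add0n addn1 add1n ltnS.
  apply: sub_count => r /andP[pr r4]; rewrite /U /=.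
  have n2 : r %% 2 != 0 by rewrite -/(_ %| _) dvdn_prime2 //; lia.
  have n3 : r %% 3 != 0 by rewrite -/(_ %| _) dvdn_prime2 //; lia.
  by lia.
have e1 : count (fun r => r == 1 %[mod 6]) (upto y) = (y + 6 - 1) %/ 6.
  by rewrite -size_filter filter_progression // size_map size_iota.
have e2 : count (fun r => r == 5 %[mod 6]) (upto y) = (y + 6 - 5) %/ 6.
  by rewrite -size_filter filter_progression // size_map size_iota.
move: H; rewrite e1 e2; case: (posnP y) => [->|]; first by rewrite /index_iota.
by lia.
Qed.

Lemma size_primes_sqr c n : 0 < c -> c * (3 * size (primes_sqr c n)) ^ 2 <= n.
Proof.
move=> c0; pose y := Nat.sqrt (n %/ c).
have ys : c * y ^ 2 <= n.
  have := leq_divM n c; have [+ _] := Nat.sqrt_spec (n %/ c) (Nat.le_0_l _); rewrite -/y; nia.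
apply: leq_trans ys; rewrite leq_mul2l leq_exp2r // orbC; apply/orP; left.
apply: (leq_trans _ (count_large_primes y)); rewrite leq_mul2l /= -size_filter.
apply: uniq_leq_size; first exact: primes_sqr_uniq.
move=> r; rewrite mem_primes_sqr // mem_filter mem_index_iota => /and3P[-> r4 h]; rewrite r4 /=.
have : r * r <= n %/ c by rewrite leq_divRL // mulnC mulnn.
move=> /leP/Nat.sqrt_le_square/leP; rewrite -/y; lia.
Qed.

Lemma INR_le_sqrt m n c : c * m ^ 2 <= n -> (INR m * sqrt (INR c) <= sqrt (INR n))%R.
Proof.
rewrite -mulnn => /INR_le; rewrite !mult_INR => h'.
have m0 := pos_INR m; have c0 := pos_INR c.
rewrite -{1}(sqrt_square (INR m)) // -sqrt_mult //; last by apply: Rmult_le_pos.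
by apply: sqrt_le_1_alt; lra.
Qed.

Lemma INR_size_primes_sqr c n : 0 < c ->
  (3 * INR (size (primes_sqr c n)) * sqrt (INR c) <= sqrt (INR n))%R.
Proof.
move=> c0; have := INR_le_sqrt (size_primes_sqr n c0).
by rewrite mult_INR (_ : INR 3 = 3%R) //=; lra.
Qed.

(** A proper prime power coprime to 12 has a base p > 4 with p^2 <= n, and all powers of one p up to
    n weigh at most log n together. *)
Lemma sum_lam_nonprime n :
  (\rsum_(d <- upto n | coprime d 12 && ~~ prime d) lam d
   <= INR (size (primes_sqr 1 n)) * L n)%R.
Proof.
have -> : (INR (size (primes_sqr 1 n)) * L n = \rsum_(p <- primes_sqr 1 n) L n)%R.
  by rewrite rsum_const count_predT.
apply: (@Rle_trans _ (\rsum_(p <- primes_sqr 1 n) \rsum_(d <- upto n | p %| d) lam d)); last first.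
  by apply: rsum_le => p; rewrite mem_primes_sqr // => /and3P[pp _ _] _; apply: sum_lam_p_part_le.
apply: rsum_cover => [i _|d]; first exact: lam_ge0.
rewrite mem_index_iota => /andP[d0 dn] /andP[cd npd] ld.
case: (lamP d0) => [//|[p [[|k] [pp e _]]]]; first by rewrite e expn1 pp in npd.
have pd : p %| d by rewrite e expnS dvdn_mulr.
exists p => //; rewrite mem_primes_sqr // pp mul1n /=; apply/andP; split.
  have cp : coprime p 12 by apply: coprime_dvdl pd cd.
  have p1 := prime_gt1 pp; case: (p) cp p1 => [|[|[|[|[|q]]]]] //.
apply: (@leq_trans (p ^ k.+2)); first by rewrite leq_exp2l ?(prime_gt1 pp).
by rewrite -e -ltnS.
Qed.

(* n * rho q e is the main term of the bound for the primes p = n mod q^e, p = a mod 12. *)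
Definition rho (q e : nat) : R :=
  (kappa (12 * q ^ e) / (INR (12 * q ^ e) - 1))%R.

(** The quotient is largest at q = 5, where it is log 5 / 4; the tangent of the logarithm at 5
    handles the other q. *)
Lemma L_prime_ratio q : prime q -> 4 < q -> (L q / (INR q - 1) <= 0.4025)%R.
Proof.
move=> _ q4; have q5 : (5 <= INR q)%R by have := @INR_le 5 q q4; rewrite /=; lra.
apply: (Rmult_le_reg_r (INR q - 1)); first lra.
rewrite /Rdiv Rmult_assoc Rinv_l ?Rmult_1_r; last lra.
have l5 : (100000000 * L 5 <= 160974880)%R.
  have := @log_hiP 5 isT; rewrite /log_scale.
  have v : (log_hi 5 <= 160974880)%Z by apply/Z.leb_spec0; vm_compute.
  by move/IZR_le: v; lra.
have : (L q <= L 5 + (INR q / 5 - 1))%R.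
  have q0 : (0 < INR q / 5)%R by lra.
  have := ln_le_sub1 q0; rewrite ln_div; try lra.
  by rewrite /L (_ : INR 5 = 5%R) //=; lra.
lra.
Qed.

(** [kappa] exceeds log Q by at most log 2 + log 3 / 2 + 0.4025 < 1.646, and log Q >= log 60 >
    4.094; with Q / (Q - 1) <= 60/59 the ratio stays below 1.43. *)
Lemma kappa_ratio_le q e : prime q -> 4 < q -> 0 < e -> let Q := 12 * q ^ e in
  (0 <= rho q e /\ rho q e * INR Q <= 1.45 * L Q)%R.
Proof.
move=> pq q4 e0 Q; have Q60 : 60 <= Q.
  rewrite /Q; case: (e) e0 => // k _; rewrite expnS.
  have : 0 < q ^ k by rewrite expn_gt0 (prime_gt0 pq).
  nia.
have Q60' : (60 <= INR Q)%R by have := INR_le Q60; rewrite (INR_Z (erefl : Z.of_nat 60 = 60%Z)).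
have k0 : (0 <= kappa Q)%R by apply: Rle_trans (kappa_ge Q); apply: L_ge0.
have i0 : (0 < / (INR Q - 1))%R by apply: Rinv_0_lt_compat; lra.
split; first by apply: Rmult_le_pos => //; left.
have L60 : (4.094 <= L Q)%R.
  apply: Rle_trans (L_le (isT : 0 < 60) Q60).
  have := @log_loP 60 isT; rewrite /log_scale.
  have v : (409410000 <= log_lo 60)%Z by apply/Z.leb_spec0; vm_compute.
  by move/IZR_le: v; lra.
have l2 : (100000000 * L 2 <= 69320988)%R.
  by have := @log_hiP 2 isT; rewrite /log_scale (_ : log_hi 2 = 69320988%Z) //; vm_compute.
have l3 : (100000000 * L 3 <= 109867655)%R.
  by have := @log_hiP 3 isT; rewrite /log_scale (_ : log_hi 3 = 109867655%Z) //; vm_compute.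
have lq := L_prime_ratio pq q4.
have kQ : (kappa Q <= L Q + 1.646)%R by rewrite /Q kappa_12 //; lra.
have -> : (rho q e * INR Q = kappa Q + kappa Q * / (INR Q - 1))%R.
  by rewrite /rho -/Q; field; lra.
have : (/ (INR Q - 1) <= / 59)%R by apply: Rinv_le_contravar; lra.
move=> h; have : (kappa Q * / (INR Q - 1) <= kappa Q * / 59)%R by apply: Rmult_le_compat_l.
lra.
Qed.

(** 2.9 is twice 1.45: for the least s with n <= Q^s, s log Q <= log n + log Q <= 2 log n. *)
Lemma psi_killed_bound n a q e : prime q -> 4 < q -> 0 < e -> coprime a 12 ->
  (psi (killed n a (q ^ e)) n <= rho q e * INR n +
     (if (12 * q ^ e <= n)%N then 2.9 * L n else L n))%R.
Proof.
move=> pq q4 e0 ca; have [r0 rQ] := kappa_ratio_le pq q4 e0.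
have n0 := pos_INR n; have rn : (0 <= rho q e * INR n)%R by apply: Rmult_le_pos.
case: leqP => Qn; last by have := psi_killed_le_ln pq q4 e0 ca Qn; lra.
set Q := 12 * q ^ e in rQ Qn *.
have Q1 : 1 < Q.
  have : 0 < q ^ e by rewrite expn_gt0 (prime_gt0 pq).
  by rewrite /Q; lia.
pose s := up_log Q n.
have s0 : 0 < s by rewrite up_log_gt0; lia.
have ns : n <= Q ^ s := up_logP n Q1.
have := psi_killed_le pq q4 e0 ca s0 ns; rewrite -/Q => h; apply: Rle_trans h _.
have Q2 : (2 <= INR Q)%R by apply: (@INR_le 2).
have -> : (kappa Q * ((INR n + INR s * INR Q) / (INR Q - 1)) =
  rho q e * INR n + INR s * (rho q e * INR Q))%R by rewrite /rho -/Q; field; lra.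
apply: Rplus_le_compat_l.
have : (INR s * (rho q e * INR Q) <= INR s * (1.45 * L Q))%R.
  by apply: Rmult_le_compat_l => //; apply: pos_INR.
have LQn : (L Q <= L n)%R by apply: L_le; lia.
have : (INR s * L Q <= L n + L Q)%R; last lra.
have pw k : L (Q ^ k) = (INR k * L Q)%R.
  elim: k => [|k IH]; first by rewrite expn0 L1 /= Rmult_0_l.
  by rewrite expnS LM ?expn_gt0 ?IH ?S_INR; [lra|lia|lia].
have : (L (Q ^ s.-1) <= L n)%R.
  apply: L_le; first by rewrite expn_gt0; lia.
  by apply: ltnW; have /andP[] := @up_log_bounds Q n Q1 ltac:(lia).
by rewrite pw -{2}(prednK s0) S_INR; lra.
Qed.

(** * Numerical size of the excluded classes *)

Definition rho_hi (q e : nat) : Z :=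
  let kap := (3 * log_hi 2 + 3 * log_hi 3 / 2 + 1 + Z.of_nat e * log_hi q
              + log_hi q / (Z.of_nat q - 1) + 1)%Z in
  (kap / (12 * Z.of_nat q ^ Z.of_nat e - 1) + 1)%Z.

Lemma kappa_expand q e : prime q -> 4 < q -> 0 < e ->
  kappa (12 * q ^ e) =
  (3 * L 2 + 3 * L 3 / 2 + INR e * L q + L q / (INR q - 1))%R.
Proof.
move=> pq q4 e0; rewrite kappa_12 // LM ?expn_gt0 ?(prime_gt0 pq) //.
have -> : L 12 = (2 * L 2 + L 3)%R by rewrite -[12]/(2 * 2 * 3) !LM //; lra.
have -> : L (q ^ e) = (INR e * L q)%R; last lra.
elim: (e) => [|k IH]; first by rewrite expn0 L1 /= Rmult_0_l.
by rewrite expnS LM ?expn_gt0 ?(prime_gt0 pq) // IH S_INR; lra.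
Qed.

Lemma INR_12exp q e : INR (12 * q ^ e) = IZR (12 * Z.of_nat q ^ Z.of_nat e).
Proof.
rewrite INR_IZR_INZ; congr IZR; elim: e => [|e IH] //.
by rewrite expnS Nat2Z.inj_succ Z.pow_succ_r; lia.
Qed.

Lemma rho_le q e : prime q -> 4 < q -> 0 < e -> (rho q e <= IZR (rho_hi q e) / 100000000)%R.
Proof.
move=> pq q4 e0; rewrite /rho kappa_expand //.
have q0 : 0 < q by lia.
set kap := (3 * L 2 + _ + _ + _)%R; rewrite /rho_hi; set kz := (3 * log_hi 2 + _ + _ + _ + _ + _)%Z.
rewrite INR_12exp -minus_IZR; set Q := (12 * Z.of_nat q ^ Z.of_nat e)%Z.
have Q1 : (0 < Q - 1)%Z.
  by rewrite /Q; have := Z.pow_pos_nonneg (Z.of_nat q) (Z.of_nat e) ltac:(lia) ltac:(lia); lia.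
have Q1' : (0 < IZR (Q - 1))%R by apply: IZR_lt.
have kk : (100000000 * kap <= IZR kz)%R.
  have := log_hiP q0; have := @log_hiP 2 isT; have := @log_hiP 3 isT.
  have := @IZR_div_ge (3 * log_hi 3) 2 erefl.
  have := @IZR_div_ge (log_hi q) (Z.of_nat q - 1) ltac:(lia).
  rewrite /log_scale /kap /kz; move: (log_hi 2) (log_hi 3) (log_hi q) => a b c.
  move: (3 * b / 2)%Z (c / (Z.of_nat q - 1))%Z => b' c'.
  rewrite mult_IZR minus_IZR -INR_IZR_INZ !plus_IZR !mult_IZR -INR_IZR_INZ.
  have q5 : (5 <= INR q)%R by have := @INR_le 5 q q4; rewrite /=; lra.
  move=> h1 h2 h3 h4 h5.
  have i0 : (0 < / (INR q - 1))%R by apply: Rinv_0_lt_compat; lra.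
  have : (100000000 * L q / (INR q - 1) <= IZR c / (INR q - 1))%R.
    by apply: Rmult_le_compat_r; lra.
  have : (INR e * (100000000 * L q) <= INR e * IZR c)%R.
    by apply: Rmult_le_compat_l => //; apply: pos_INR.
  lra.
have := IZR_div_ge kz Q1; set X := IZR (_ + 1) => h.
have : (100000000 * kap / IZR (Q - 1) <= IZR kz / IZR (Q - 1))%R.
  by apply: Rmult_le_compat_r => //; left; apply: Rinv_0_lt_compat.
lra.
Qed.

Definition mid_primes := [seq r <- iota 11 90 | prime r].

(* Majorizes [rho r 2]; unlike [rho], it is summed over all r = 6 i - 1 and 6 i + 1 at once. *)
Definition tau (r : nat) : R := ((2 * L r + 3.78) / (12 * (INR r * INR r)))%R.

Lemma L2_hi : (100000000 * L 2 <= 69320988)%R.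
Proof. by have := @log_hiP 2 isT; rewrite /log_scale (_ : log_hi 2 = 69320988%Z) //; vm_compute. Qed.

Lemma L3_hi : (100000000 * L 3 <= 109867655)%R.
Proof. by have := @log_hiP 3 isT; rewrite /log_scale (_ : log_hi 3 = 109867655%Z) //; vm_compute. Qed.

Lemma INR_ge c n : c <= n -> (IZR (Z.of_nat c) <= INR n)%R.
Proof. by rewrite -INR_IZR_INZ; apply: INR_le. Qed.

(* Concavity: the tangent to the logarithm at c. *)
Lemma L_le_tangent c q : 0 < c -> 0 < q -> (L q <= L c + INR q / INR c - 1)%R.
Proof.
move=> /INR0lt c0 /INR0lt q0.
have := ln_le_sub1 (Rdiv_lt_0_compat _ _ q0 c0); rewrite ln_div // /L; lra.
Qed.

(** For r > 100, 3 log 2 + (3/2) log 3 + log r / (r - 1) < 3.775; raising this to 3.78 pays for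
    dropping the -1 in the denominator. *)
Lemma rho_le_tau r : prime r -> 100 < r -> (rho r 2 <= tau r)%R.
Proof.
move=> pr r100; rewrite /rho kappa_expand //; last by lia.
have r1 : (101 <= INR r)%R := INR_ge r100.
have -> : INR (12 * r ^ 2) = (12 * (INR r * INR r))%R.
  by rewrite -mulnn !mult_INR (INR_Z (erefl : Z.of_nat 12 = 12%Z)).
have l := @L_le_tangent 101 r isT ltac:(lia); rewrite (INR_Z (erefl : Z.of_nat 101 = 101%Z)) in l.
have l101 : (100000000 * L 101 <= 461550000)%R.
  apply: Rle_trans (@log_hiP 101 isT) _; apply: IZR_le; apply/Z.leb_spec0; vm_compute.
  by [].
have lr : (L r / (INR r - 1) <= 0.0462)%R.
  apply: (Rmult_le_reg_r (INR r - 1)); first lra.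
  by rewrite /Rdiv Rmult_assoc Rinv_l; lra.
have l0 := L_ge0 r; have := L2_hi; have := L3_hi => h3 h2.
have rr : (10201 <= INR r * INR r)%R by nra.
rewrite /tau; apply: (@Rle_trans _ ((2 * L r + 3.775) / (12 * (INR r * INR r) - 1))).
  apply: Rmult_le_compat_r; first by left; apply: Rinv_0_lt_compat; lra.
  by rewrite (_ : INR 2 = 2%R) //; lra.
apply: (Rmult_le_reg_r ((12 * (INR r * INR r)) * (12 * (INR r * INR r) - 1))).
  by apply: Rmult_lt_0_compat; lra.
set S := (12 * (INR r * INR r))%R in rr *.
have S0 : (122412 <= S)%R by rewrite /S; lra.
have -> : ((2 * L r + 3.775) / (S - 1) * (S * (S - 1)) = (2 * L r + 3.775) * S)%R by field; lra.
have -> : ((2 * L r + 3.78) / S * (S * (S - 1)) = (2 * L r + 3.78) * (S - 1))%R by field; lra.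
have : (L r <= INR r)%R by lra.
rewrite /S; nra.
Qed.

(** A telescoping majorant. The squares of 6 i - 1 and 6 i + 1 have reciprocals summing to at most D
    / 9, where D = 1/(2i-1) - 1/(2i+1); raising 3.78 to 5.78 compensates the growth of the logarithm
    from i to i + 1. *)
Definition tau_potential (i : nat) : R :=
  ((2 * L (6 * i + 1) + 5.78) / (108 * (2 * INR i - 1)))%R.

Lemma tau_pair i : 0 < i ->
  (tau (6 * i - 1) + tau (6 * i + 1) <= tau_potential i - tau_potential i.+1)%R.
Proof.
move=> i0; have i1 : (1 <= INR i)%R := INR_ge i0.
have e1 : INR (6 * i - 1) = (6 * INR i - 1)%R.
  by rewrite !INR_IZR_INZ -mult_IZR -minus_IZR; congr IZR; lia.
have e2 : INR (6 * i + 1) = (6 * INR i + 1)%R.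
  by rewrite !INR_IZR_INZ -mult_IZR -plus_IZR; congr IZR; lia.
have e3 : INR (6 * i.+1 + 1) = (6 * INR i + 7)%R.
  by rewrite !INR_IZR_INZ -mult_IZR -plus_IZR; congr IZR; lia.
have lm : (L (6 * i - 1) <= L (6 * i + 1))%R by apply: L_le; lia.
have := @L_le_tangent (6 * i + 1) (6 * i.+1 + 1) ltac:(lia) ltac:(lia).
rewrite e2 e3 /tau /tau_potential e1 e2 S_INR.
set l := L (6 * i + 1) in lm *; set l' := L (6 * i.+1 + 1).
set x := INR i in i1 *; have l0 : (0 <= l)%R := L_ge0 _.
move=> hl.
have {}hl : (l' <= l + 6 / (6 * x + 1))%R.
  have -> : (6 / (6 * x + 1) = (6 * x + 7) / (6 * x + 1) - 1)%R by field; lra.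
  lra.
have P0 : (0 < (6 * x - 1) * (6 * x - 1))%R by nra.
have P1 : (0 < (6 * x + 1) * (6 * x + 1))%R by nra.
pose D := (2 / ((2 * x - 1) * (2 * x + 1)))%R.
have D0 : (0 < (2 * x - 1) * (2 * x + 1))%R by nra.
have up : (tau (6 * i - 1) + tau (6 * i + 1) <= (2 * l + 3.78) / 108 * D)%R.
  apply: (@Rle_trans _ ((2 * l + 3.78) / 12 * (/ ((6 * x - 1) * (6 * x - 1)) + / ((6 * x + 1) * (6 * x + 1))))).
    rewrite /tau e1 e2 -/x -/l.
    have -> : ((2 * l + 3.78) / (12 * ((6 * x + 1) * (6 * x + 1))) =
      (2 * l + 3.78) / 12 * / ((6 * x + 1) * (6 * x + 1)))%R by field; lra.
    have -> : ((2 * L (6 * i - 1) + 3.78) / (12 * ((6 * x - 1) * (6 * x - 1))) =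
      (2 * L (6 * i - 1) + 3.78) / 12 * / ((6 * x - 1) * (6 * x - 1)))%R by field; lra.
    have : ((2 * L (6 * i - 1) + 3.78) / 12 * / ((6 * x - 1) * (6 * x - 1)) <=
       (2 * l + 3.78) / 12 * / ((6 * x - 1) * (6 * x - 1)))%R.
      by apply: Rmult_le_compat_r; [left; apply: Rinv_0_lt_compat|lra].
    lra.
  have -> : ((2 * l + 3.78) / 108 * D = (2 * l + 3.78) / 12 * (D / 9))%R by field; lra.
  apply: Rmult_le_compat_l; first lra.
  rewrite /D; apply: (Rmult_le_reg_r (((6 * x - 1) * (6 * x - 1)) * ((6 * x + 1) * (6 * x + 1)) * ((2 * x - 1) * (2 * x + 1)))).
    by apply: Rmult_lt_0_compat => //; apply: Rmult_lt_0_compat.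
  have -> : ((/ ((6 * x - 1) * (6 * x - 1)) + / ((6 * x + 1) * (6 * x + 1))) *
    ((6 * x - 1) * (6 * x - 1) * ((6 * x + 1) * (6 * x + 1)) * ((2 * x - 1) * (2 * x + 1))) =
    ((6 * x + 1) * (6 * x + 1) + (6 * x - 1) * (6 * x - 1)) * ((2 * x - 1) * (2 * x + 1)))%R by field; lra.
  have -> : (2 / ((2 * x - 1) * (2 * x + 1)) / 9 *
    ((6 * x - 1) * (6 * x - 1) * ((6 * x + 1) * (6 * x + 1)) * ((2 * x - 1) * (2 * x + 1))) =
    2 / 9 * ((6 * x - 1) * (6 * x - 1) * ((6 * x + 1) * (6 * x + 1))))%R by field; lra.
  nra.
rewrite /tau e1 e2 -/x -/l in up; apply: Rle_trans up _.
have hl2 : ((2 * l' + 5.78) / (108 * (2 * (x + 1) - 1)) <=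
   (2 * l + 5.78) / (108 * (2 * x + 1)) + 12 / ((6 * x + 1) * (108 * (2 * x + 1))))%R.
  have -> : ((2 * l + 5.78) / (108 * (2 * x + 1)) + 12 / ((6 * x + 1) * (108 * (2 * x + 1))) =
    (2 * (l + 6 / (6 * x + 1)) + 5.78) / (108 * (2 * (x + 1) - 1)))%R by field; lra.
  by apply: Rmult_le_compat_r; [left; apply: Rinv_0_lt_compat|]; lra.
have : (12 / ((6 * x + 1) * (108 * (2 * x + 1))) <= 2 / 108 * D)%R.
  rewrite /D; apply: (Rmult_le_reg_r ((6 * x + 1) * ((2 * x - 1) * (2 * x + 1)))).
    by apply: Rmult_lt_0_compat; lra.
  have -> : (12 / ((6 * x + 1) * (108 * (2 * x + 1))) * ((6 * x + 1) * ((2 * x - 1) * (2 * x + 1))) =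
    12 / 108 * (2 * x - 1))%R by field; lra.
  have -> : (2 / 108 * (2 / ((2 * x - 1) * (2 * x + 1))) * ((6 * x + 1) * ((2 * x - 1) * (2 * x + 1))) =
    4 / 108 * (6 * x + 1))%R by field; lra.
  lra.
have -> : ((2 * l + 5.78) / (108 * (2 * x - 1)) = (2 * l + 5.78) / 108 * D + (2 * l + 5.78) / (108 * (2 * x + 1)))%R.
  by rewrite /D; field; lra.
lra.
Qed.

Lemma tau_ge0 r : (0 <= tau r)%R.
Proof.
apply: Rmult_le_pos; first by have := L_ge0 r; lra.
have [->|r0] := posnP r; first by rewrite /= Rmult_0_l Rmult_0_r Rinv_0; lra.
have := INR0lt r0 => r0'; left; apply: Rinv_0_lt_compat; nra.
Qed.

Lemma sum_tau_pairs k :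
  (\rsum_(i <- iota 17 k) (tau (6 * i - 1)%N + tau (6 * i + 1)%N) <= 0.004224)%R.
Proof.
have H : (\rsum_(i <- iota 17 k) (tau (6 * i - 1)%N + tau (6 * i + 1)%N) <=
    tau_potential 17 - tau_potential (17 + k))%R.
  elim: k => [|k IH]; first by rewrite big_nil addn0; lra.
  have -> : iota 17 k.+1 = iota 17 k ++ [:: 17 + k] by rewrite -[k.+1]addn1 iotaD.
  rewrite big_cat big_seq1 (addnS 17 k).
  have {}IH := Rplus_le_compat_r (tau (6 * (17 + k) - 1) + tau (6 * (17 + k) + 1)) _ _ IH.
  apply: Rle_trans IH _.
  by have := @tau_pair (17 + k) isT; lra.
have p0 : (0 <= tau_potential (17 + k))%R.
  apply: Rmult_le_pos; first by have := L_ge0 (6 * (17 + k) + 1); lra.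
  have : (17 <= INR (17 + k))%R by apply: (@INR_ge 17); lia.
  by move=> h; left; apply: Rinv_0_lt_compat; lra.
have : (tau_potential 17 <= 0.004224)%R; last lra.
rewrite /tau_potential (_ : 6 * 17 + 1 = 103) // (INR_Z (erefl : Z.of_nat 17 = 17%Z)).
have : (100000000 * L 103 <= 463510000)%R.
  apply: Rle_trans (@log_hiP 103 isT) _; apply: IZR_le; apply/Z.leb_spec0; vm_compute.
  by [].
lra.
Qed.

Lemma sum_rho_mid : (\rsum_(r <- mid_primes) rho r 2 <= 0.0233807)%R.
Proof.
have H l : all (fun r => prime r && (4 < r)) l ->
    (\rsum_(r <- l) rho r 2 <= IZR (foldr (fun r s => (rho_hi r 2 + s)%Z) 0%Z l) / 100000000)%R.
  elim: l => [|r l IH]; first by rewrite big_nil [foldr _ _ _]/=; lra.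
  rewrite [all _ _]/= => /andP[/andP[pr r4] /IH{}IH]; rewrite big_cons [foldr _ _ _]/=.
  by have := @rho_le r 2 pr r4 isT; rewrite plus_IZR; lra.
apply: Rle_trans (H mid_primes isT) _.
have -> : foldr (fun r s => (rho_hi r 2 + s)%Z) 0%Z mid_primes = 2338060%Z by vm_compute.
lra.
Qed.

Lemma sum_rho_sqr n :
  (\rsum_(r <- primes_sqr 1 n | (10 < r)%N) rho r 2 <= 0.027606)%R.
Proof.
(* 17 because 6 * 17 - 1 = 101; beyond 100, t keeps every number that is 1 or 5 modulo 6, prime or
   not. *)
pose t := mid_primes ++ [seq 6 * i - 1 | i <- iota 17 n] ++ [seq 6 * i + 1 | i <- iota 17 n].
pose f r := if r <= 100 then (if prime r && (4 < r) then rho r 2 else 0%R) else tau r.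
have f0 r : (0 <= f r)%R.
  rewrite /f; case: ifP => _; last exact: tau_ge0.
  by case: ifP => [/andP[pr r4]|_]; [have [] := @kappa_ratio_le r 2 pr r4 isT|right].
apply: (@Rle_trans _ (\rsum_(r <- t) f r)).
  apply: (@Rle_trans _ (\rsum_(r <- [seq r <- primes_sqr 1 n | 10 < r]) f r)).
    rewrite big_filter; apply: rsum_le => r; rewrite mem_primes_sqr // => /and3P[pr r4 _] r10.
    rewrite /f pr r4 /=; case: leqP => r100; first by right.
    exact: rho_le_tau.
  apply: rsum_uniq_sub => //; first by rewrite filter_uniq ?primes_sqr_uniq.
  move=> r; rewrite mem_filter mem_primes_sqr // => /andP[r10 /and3P[pr r4 rn]].
  rewrite !mem_cat; have [r100|r100] := leqP r 100.
    by rewrite mem_filter pr mem_iota r10 /=; apply/orP; left; lia.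
  have n2 : r %% 2 != 0 by rewrite -/(_ %| _) dvdn_prime2 //; lia.
  have n3 : r %% 3 != 0 by rewrite -/(_ %| _) dvdn_prime2 //; lia.
  have rn' : r <= n by move: rn; rewrite -mulnn; nia.
  apply/orP; right; apply/orP; have [r5|r1] : r %% 6 = 5 \/ r %% 6 = 1 by lia.
    by left; apply/mapP; exists (r %/ 6).+1; [rewrite mem_iota|]; lia.
  by right; apply/mapP; exists (r %/ 6); [rewrite mem_iota|]; lia.
have -> : \rsum_(r <- t) f r = (\rsum_(r <- mid_primes) f r
    + \rsum_(i <- iota 17 n) (f (6 * i - 1)%N + f (6 * i + 1)%N))%R.
  by rewrite /t !big_cat !big_map big_split.
have tail : (\rsum_(i <- iota 17 n) (f (6 * i - 1)%N + f (6 * i + 1)%N) <= 0.004224)%R.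
  apply: Rle_trans (sum_tau_pairs n); apply: rsum_le => i; rewrite mem_iota => /andP[i17 _] _.
  have h1 : (6 * i - 1 <= 100) = false by lia.
  have h2 : (6 * i + 1 <= 100) = false by lia.
  by rewrite /f h1 h2; right.
have mid : (\rsum_(r <- mid_primes) f r <= 0.0233807)%R.
  rewrite (eq_big_seq (fun r => rho r 2)); first exact: sum_rho_mid.
  move=> r; rewrite mem_filter mem_iota => /andP[pr /andP[r10 r100]].
  have h1 : r <= 100 by lia.
  have h2 : 4 < r by lia.
  by rewrite /f h1 h2 pr.
lra.
Qed.

Lemma rho1_le q : prime q -> 10 < q -> (rho q 1 <= 0.0487)%R.
Proof.
move=> pq q10; rewrite /rho kappa_expand //; last lia.
rewrite expn1; have q11 : (11 <= INR q)%R := INR_ge q10.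
have -> : INR (12 * q) = (12 * INR q)%R.
  by rewrite !INR_IZR_INZ -mult_IZR; congr IZR; lia.
have l := @L_le_tangent 11 q isT ltac:(lia); rewrite (INR_Z (erefl : Z.of_nat 11 = 11%Z)) in l.
have l11 : (100000000 * L 11 <= 239830000)%R.
  apply: Rle_trans (@log_hiP 11 isT) _; apply: IZR_le; apply/Z.leb_spec0; vm_compute.
  by [].
have lr : (L q / (INR q - 1) <= 0.23983)%R.
  apply: (Rmult_le_reg_r (INR q - 1)); first lra.
  by rewrite /Rdiv Rmult_assoc Rinv_l; lra.
have := L2_hi; have := L3_hi => h3 h2.
apply: (Rmult_le_reg_r (12 * INR q - 1)); first lra.
rewrite {1}/Rdiv Rmult_assoc Rinv_l; last lra.
rewrite (_ : INR 1 = 1%R) //; lra.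
Qed.

Lemma rho_small : (rho 5 1 <= 0.09729 /\ rho 7 1 <= 0.07227 /\
  rho 5 2 <= 0.02458 /\ rho 7 2 <= 0.013534)%R.
Proof.
have H q e z : prime q -> 4 < q -> 0 < e -> rho_hi q e = z -> (rho q e <= IZR z / 100000000)%R.
  by move=> pq q4 e0 <-; apply: rho_le.
have h1 := @H 5 1 9728005%Z isT isT isT ltac:(by vm_compute).
have h2 := @H 7 1 7226444%Z isT isT isT ltac:(by vm_compute).
have h3 := @H 5 2 2457868%Z isT isT isT ltac:(by vm_compute).
have h4 := @H 7 2 1353309%Z isT isT isT ltac:(by vm_compute).
lra.
Qed.

(** A prime moved into [qs] pays [rho q 1] but saves its square. Everything is bounded linearly in
    the indicators of 5 and 7, and the extreme value is 0.09729 + 0.07227 + 0.027606. *)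
Lemma sum_rho n (qs : seq nat) : uniq qs -> size qs <= 2 ->
  (forall q, q \in qs -> prime q /\ 4 < q) ->
  (\rsum_(q <- qs) rho q 1 + \rsum_(r <- primes_sqr 1 n | r \notin qs) rho r 2 <= 0.19718)%R.
Proof.
move=> uq sq pq; have [h51 [h71 [h52 h72]]] := rho_small.
(* 0.0487 serves every q >= 11; 0.04859 and 0.02357 are the surcharges for 5 and 7. *)
have A : (\rsum_(q <- qs) rho q 1 <= 0.0487 * INR (size qs) + 0.04859 * INR (5 \in qs)%N + 0.02357 * INR (7 \in qs)%N)%R.
  rewrite -!count_uniq_mem //; apply: (@Rle_trans _ (\rsum_(q <- qs)
     (0.0487 + 0.04859 * INR (q == 5)%N + 0.02357 * INR (q == 7)%N))).
    apply: rsum_le => q /pq[pp q4] _.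
    have [->|q5] := eqVneq q 5; first by rewrite (_ : INR true = 1%R) // (_ : INR (5 == 7)%N = 0%R) //; lra.
    have [->|q7] := eqVneq q 7; first by rewrite (_ : INR true = 1%R) // (_ : INR false = 0%R) //; lra.
    rewrite (_ : INR false = 0%R) //; have q10 : 10 < q.
      have : all (fun q => ~~ prime q || (q == 5) || (q == 7)) (iota 5 6) by [].
      rewrite ltnNge; apply: contraL => q10; apply/allPn; exists q; first by rewrite mem_iota; lia.
      by rewrite pp (negbTE q5) (negbTE q7).
    by have := rho1_le pp q10; lra.
  have H c : \rsum_(q <- qs) INR (q == c)%N = INR (count_mem c qs).
    by elim: (qs) => [|q l IH]; rewrite ?big_nil // big_cons IH [count _ _]/= plus_INR.
  rewrite !big_split /=; apply: Req_le; congr (_ + _ + _)%R.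
  - by rewrite rsum_const count_predT Rmult_comm.
  - by rewrite -big_distrr H.
  - by rewrite -big_distrr H.
have B : (\rsum_(r <- primes_sqr 1 n | r \notin qs) rho r 2 <=
    0.02458 * (1 - INR (5 \in qs)%N) + 0.013534 * (1 - INR (7 \in qs)%N) + 0.027606)%R.
  pose t := [seq r <- [:: 5; 7] | r \notin qs] ++ [seq r <- primes_sqr 1 n | 10 < r].
  have m0 r : r \in primes_sqr 1 n -> (0 <= rho r 2)%R.
    by rewrite mem_primes_sqr // => /and3P[pr r4 _]; have [] := @kappa_ratio_le r 2 pr r4 isT.
  apply: (@Rle_trans _ (\rsum_(r <- t) rho r 2)).
    rewrite -big_filter; apply: rsum_uniq_sub; first by rewrite filter_uniq ?primes_sqr_uniq.
      move=> r; rewrite mem_filter => /andP[rq rn]; rewrite mem_cat; apply/orP.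
      have [r10|r10] := ltnP 10 r; first by right; rewrite mem_filter r10.
      left; rewrite mem_filter rq /=; move: rn; rewrite mem_primes_sqr // => /and3P[pr r4 _].
      have H' : all (fun q => ~~ prime q || (q \in [:: 5; 7])) (iota 5 6) by [].
      have ri : r \in iota 5 6 by rewrite mem_iota; lia.
      by have := allP H' r ri; rewrite pr.
    move=> r; rewrite mem_cat => /orP[|]; rewrite mem_filter => /andP[_]; last exact: m0.
    rewrite !inE => /orP[]/eqP ->; first by have [] := @kappa_ratio_le 5 2 isT isT isT.
    by have [] := @kappa_ratio_le 7 2 isT isT isT.
  rewrite /t big_cat.
  have h : (\rsum_(r <- [seq r <- [:: 5; 7] | r \notin qs]%N) rho r 2 <=
     0.02458 * (1 - INR (5 \in qs)%N) + 0.013534 * (1 - INR (7 \in qs)%N))%R.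
    rewrite big_filter !big_cons big_nil.
    by case: (5 \in qs); case: (7 \in qs); rewrite /=; lra.
  have := sum_rho_sqr n; rewrite -big_filter => h2.
  by apply: Rle_trans (Rplus_le_compat _ _ _ _ h h2) _; lra.
have s2 : (INR (size qs) <= 2)%R by apply: (@INR_le _ 2).
have : (INR (5 \in qs)%N + INR (7 \in qs)%N <= INR (size qs))%R.
  rewrite -plus_INR; apply: (@INR_le ((5 \in qs) + (7 \in qs))); rewrite -!count_uniq_mem //.
  rewrite -count_predUI (_ : count (predI _ _) qs = 0) ?addn0 ?count_size //.
  by apply/eqP; rewrite -leqn0 leqNgt -has_count; apply/hasPn => q _ /=; case: eqP => // ->.
have b01 (b : bool) : INR b = 0%R \/ INR b = 1%R by case: b; [right|left].
move: A B; case: (b01 (5 \in qs)) => ->; case: (b01 (7 \in qs)) => ->; lra.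
Qed.

(** * Large n *)

Lemma psi_class_cover n a (ms : seq nat) : coprime a 12 ->
  (forall d, 0 < d <= n -> prime d -> d == a %[mod 12] ->
     exists2 m, m \in ms & d == n %[mod m]) ->
  (psi (fun d => d == a %[mod 12]) n
   <= INR (size (primes_sqr 1 n)) * L n + \rsum_(m <- ms) psi (killed n a m) n)%R.
Proof.
move=> ca H; rewrite /psi (bigID prime) /= Rplus_comm; apply: Rplus_le_compat.
  apply: Rle_trans (sum_lam_nonprime n).
  apply: rsum_sub => [d _ /andP[/eqP da ->]|d _ _ _]; last exact: lam_ge0.
  by rewrite andbT -coprime_modl da coprime_modl.
apply: rsum_cover => [d _|d]; first exact: lam_ge0.
rewrite mem_index_iota ltnS => dn /andP[da pd] _.
have [m mm dm] := H d dn pd da; exists m => //.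
by rewrite /killed pd da dm.
Qed.

(** By minimality of s, 12^(s-1) * 200 <= n; the constants are 1 / log 12 and 1 - log 200 / log 12,
    rounded. *)
Lemma up_log12_le n : 400 * 1000 <= n ->
  (INR (up_log 12 (n %/ 200)) <= 0.40247 * L n - 1.132)%R.
Proof.
move=> nN; set s := up_log 12 _; have n2 : 1 < n %/ 200 by rewrite (leq_divRL _ _ (isT : 0 < 200)); lia.
have s0 : 0 < s by rewrite up_log_gt0 n2.
have /andP[lt _] := @up_log_bounds 12 (n %/ 200) isT n2.
rewrite -/s in lt.
have pw k : L (12 ^ k) = (INR k * L 12)%R.
  elim: k => [|k IH]; first by rewrite expn0 L1 /= Rmult_0_l.
  by rewrite expnS LM ?expn_gt0 // IH S_INR; lra.
have h : (L (12 ^ s.-1 * 200) <= L n)%R.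
  apply: L_le; first by rewrite muln_gt0 expn_gt0.
  by rewrite -leq_divRL // ltnW.
rewrite LM ?expn_gt0 // pw in h.
have : INR s = (INR s.-1 + 1)%R by rewrite -{1}(prednK s0) S_INR.
have l12 : (248470000 <= 100000000 * L 12)%R.
  apply: Rle_trans (@log_loP 12 isT); apply: IZR_le; apply/Z.leb_spec0; vm_compute.
  by [].
have l200 : (529810000 <= 100000000 * L 200)%R.
  apply: Rle_trans (@log_loP 200 isT); apply: IZR_le; apply/Z.leb_spec0; vm_compute.
  by [].
move=> ->; have : (INR s.-1 * 2.4847 <= INR s.-1 * L 12)%R.
  by apply: Rmult_le_compat_l; [exact: pos_INR|lra].
have := L_ge0 n; lra.
Qed.

Definition sqr_moduli (n : nat) (qs : seq nat) : seq nat :=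
  [seq r ^ 2 | r <- primes_sqr 1 n & r \notin qs].

(** 5.8 is 2.9 for each of the at most two q. Every square costs log n, and those with 12 r^2 <= n
    another 1.9 log n. *)
Lemma psi_killed_total_le n a (qs : seq nat) : coprime a 12 -> uniq qs -> size qs <= 2 ->
  (forall q, q \in qs -> prime q /\ 4 < q) ->
  (\rsum_(m <- qs ++ sqr_moduli n qs) psi (killed n a m) n
   <= 0.19718 * INR n
      + (5.8 + INR (size (primes_sqr 1 n)) + 1.9 * INR (size (primes_sqr 12 n))) * L n)%R.
Proof.
move=> ca uq sq pq; have l0 := L_ge0 n; have n0 := pos_INR n.
have A : (\rsum_(q <- qs) psi (killed n a q) n <=
    \rsum_(q <- qs) (rho q 1 * INR n) + 5.8 * L n)%R.
  apply: (@Rle_trans _ (\rsum_(q <- qs) (rho q 1 * INR n + 2.9 * L n))).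
    apply: rsum_le => q /pq[pp q4] _.
    have := @psi_killed_bound n a q 1 pp q4 isT ca; rewrite expn1.
    by case: ifP => _; lra.
  rewrite big_split /= rsum_const count_predT; apply: Rplus_le_compat_l.
  have : (INR (size qs) <= 2)%R by apply: (@INR_le _ 2).
  by move=> s2; have := pos_INR (size qs); nra.
have B : (\rsum_(m <- sqr_moduli n qs) psi (killed n a m) n <=
    \rsum_(r <- primes_sqr 1 n | r \notin qs) (rho r 2 * INR n) +
    (INR (size (primes_sqr 1 n)) + 1.9 * INR (size (primes_sqr 12 n))) * L n)%R.
  rewrite big_map big_filter.
  apply: (@Rle_trans _ (\rsum_(r <- primes_sqr 1 n | r \notin qs)
      (rho r 2 * INR n + (if (12 * r ^ 2 <= n)%N then 2.9 * L n else L n)))).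
    apply: rsum_le => r; rewrite mem_primes_sqr // => /and3P[pr r4 _] _.
    exact: (@psi_killed_bound n a r 2 pr r4 isT ca).
  rewrite big_split /=; apply: Rplus_le_compat_l.
  apply: (@Rle_trans _ (\rsum_(r <- primes_sqr 1 n)
      (L n + INR (12 * r ^ 2 <= n)%N * (1.9 * L n)))).
    rewrite big_mkcond; apply: rsum_le => r _ _.
    case: (r \notin qs); case: leqP => _; rewrite /=; lra.
  have e : \rsum_(r <- primes_sqr 1 n) INR (12 * r ^ 2 <= n)%N = INR (size (primes_sqr 12 n)).
    transitivity (INR (count (fun r => 12 * r ^ 2 <= n) (primes_sqr 1 n))).
      elim: (primes_sqr 1 n) => [|r l IH]; first by rewrite big_nil.
      by rewrite big_cons IH [count _ _]/= plus_INR.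
    congr INR; rewrite -size_filter /primes_sqr -filter_predI; congr size.
    apply: eq_filter => r /=; rewrite mul1n andbC -!andbA; congr (_ && (_ && _)).
    by apply/andb_idl => h; apply: leq_trans h; rewrite leq_pmull.
  rewrite big_split /= rsum_const count_predT -big_distrl /= e; lra.
rewrite big_cat /=; apply: Rle_trans (Rplus_le_compat _ _ _ _ A B) _.
rewrite -!big_distrl /=; have := sum_rho n uq sq pq.
set S1 := bigop _ _ _; set S2 := bigop _ _ _ => h.
have : ((S1 + S2) * INR n <= 0.19718 * INR n)%R by apply: Rmult_le_compat_r.
lra.
Qed.

(** With u = sqrt n, the tangent at u = 632, just below the square root of 400000, gives log n <=
    10.8982 + u / 316, which leaves a polynomial inequality in u. The constant 10.392 is 3 times
    3.464, a lower bound for sqrt 12. *)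
Lemma excluded_lt_class n : 400 * 1000 <= n ->
  (INR (size (primes_sqr 1 n)) * L n + (0.19718 * INR n
      + (5.8 + INR (size (primes_sqr 1 n)) + 1.9 * INR (size (primes_sqr 12 n))) * L n)
   < 0.22334 * INR n - 33.5 * (L n + 1 / 12) - 268.5 * INR (up_log 12 (n %/ 200)))%R.
Proof.
move=> nN; have sl := up_log12_le nN.
have nR : (400000 <= INR n)%R.
  rewrite INR_IZR_INZ; apply: IZR_le; lia.
pose u := sqrt (INR n).
have u2 : (u * u = INR n)%R by apply: sqrt_sqrt; lra.
have u0 : (632 <= u)%R.
  rewrite -(sqrt_square 632); last lra.
  by apply: sqrt_le_1_alt; lra.
have c1 := @INR_size_primes_sqr 1 n isT; have c12 := @INR_size_primes_sqr 12 n isT.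
rewrite -/u (_ : INR 1 = 1%R) // sqrt_1 in c1.
have s12 : (3.464 <= sqrt (INR 12))%R.
  rewrite -(sqrt_square 3.464); last lra.
  by apply: sqrt_le_1_alt; rewrite (INR_Z (erefl : Z.of_nat 12 = 12%Z)); lra.
rewrite -/u in c12.
have l632 : (100000000 * L 632 <= 644910000)%R.
  apply: Rle_trans (@log_hiP 632 isT) _; apply: IZR_le; apply/Z.leb_spec0; vm_compute.
  by [].
have Ln : (L n <= 10.8982 + u / 316)%R.
  have -> : L n = (2 * ln u)%R by rewrite /L -u2 ln_mult; lra.
  have q0 : (0 < u / 632)%R by lra.
  have := ln_le_sub1 q0; rewrite ln_div; try lra.
  by move: l632; rewrite /L (INR_Z (erefl : Z.of_nat 632 = 632%Z)); lra.
have l0 := L_ge0 n.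
move: c1 c12 sl; set A := INR (size _); set B := INR (size _) => c1 c12 sl.
have A0 : (0 <= A)%R := pos_INR _; have B0 : (0 <= B)%R := pos_INR _.
have B1 : (B <= u / 10.392)%R.
  have : (3 * B * 3.464 <= 3 * B * sqrt (INR 12))%R by apply: Rmult_le_compat_l; lra.
  lra.
have A1 : (A <= u / 3)%R by lra.
have AL : (A * L n <= u / 3 * (10.8982 + u / 316))%R by apply: Rmult_le_compat.
have BL : (B * L n <= u / 10.392 * (10.8982 + u / 316))%R by apply: Rmult_le_compat.
have uu : (632 * u <= u * u)%R by apply: Rmult_le_compat_r; lra.
rewrite -u2; nra.
Qed.

(** * Small n: sieve and search *)

(** A trie over the binary digits of a positive; an absent branch is unmarked. *)
Inductive tree := Leaf | Node of tree & bool & tree.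

Fixpoint marked (k : positive) (t : tree) : bool :=
  match t with
  | Leaf => false
  | Node l b r =>
    match k with xH => b | xO k' => marked k' l | xI k' => marked k' r end
  end.

(* In continuation-passing style the tree stays evaluated under lazy reduction. *)
Fixpoint mark {A} (k : positive) (t : tree) (c : tree -> A) : A :=
  match k, t with
  | xH, Leaf => c (Node Leaf true Leaf)
  | xH, Node l _ r => c (Node l true r)
  | xO k', Leaf => mark k' Leaf (fun l => c (Node l false Leaf))
  | xO k', Node l b r => mark k' l (fun l => c (Node l b r))
  | xI k', Leaf => mark k' Leaf (fun r => c (Node Leaf false r))
  | xI k', Node l b r => mark k' r (fun r => c (Node l b r))
  end.

Fixpoint mark_step {A} (n : nat) (q k : positive) (t : tree) (c : tree -> A) : A :=
  if n is n'.+1 then mark k t (fun t => mark_step n' q (Pos.add k q) t c) else c t.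

(* The key k stands for the odd number 2k-1. The odd multiples q(2i+1) of q = 2h+1
   have keys qi+h+1; those below q^2 (i < h) are left to smaller primes. *)
Definition first_mult (lo q : N) : N := N.max (N.div2 q) (N.div lo q - 1).

Fixpoint sieve {A} (lo hi : N) (qs : seq N) (t : tree) (c : tree -> A) : A :=
  if qs is q :: qs' then
    let i := first_mult lo q in
    mark_step (N.to_nat (N.succ (N.div hi q) - i))
      (N.succ_pos (N.pred q)) (N.succ_pos (q * i + N.div2 q)) t
      (fun t => sieve lo hi qs' t c)
  else c t.

(** [w] records the primality of the preceding odd numbers, latest first, and [mask] tells which
    offsets are admissible primes r; success needs c + 1 common positions. *)
Fixpoint walk (mask w : seq bool) (c : nat) : bool :=
  match mask, w with
  | m :: mask', b :: w' =>
    if b then if m then if c is c'.+1 then walk mask' w' c' else true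
              else walk mask' w' c
    else walk mask' w' c
  | _, _ => false
  end.

(** At key k the head of [w] is 2k-1, which is n - 1 for n = 2k and n - 2 for n = 2k+1; if it is
    prime, eta = 1 or 2 suffices. Entry i of the rest is 2k-2i-3, that is n - r with r = 2i+3, or n
    - 2r with r = i+2, so one window serves both parities. *)
Definition walk1 (mask w : seq bool) : bool :=
  if w is b :: w' then if b then true else walk mask w' 2 else false.

Fixpoint run (me mo : seq bool) (t : tree) (n : nat) (k : positive) (w : seq bool) : bool :=
  if n is n'.+1 then
    let w' := ~~ marked k t :: w in
    if walk1 me w' then if walk1 mo w' then run me mo t n' (Pos.succ k) w' else false
    else false
  else true.

(** The first [n0] keys only fill the window and are not tested. *)
Fixpoint run_from (me mo : seq bool) (t : tree) (n0 n : nat) (k : positive) (w : seq bool) : bool :=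
  if n0 is n0'.+1 then run_from me mo t n0' n (Pos.succ k) (~~ marked k t :: w)
  else run me mo t n k w.

Definition small_primes := [seq N.of_nat q | q <- iota 3 700 & prime q].

Definition segment (lo : N) (n0 n : nat) : bool :=
  let hi := (lo + N.of_nat n0 + N.of_nat n)%num in
  let me := [seq prime i.*2.+1 | i <- iota 1 400] in
  let mo := [seq (i != 1) && prime i.+1 | i <- iota 1 800] in
  sieve lo hi [seq q <- small_primes | (q * q <? 2 * hi)%num] Leaf
    (fun t => run_from me mo t n0 n (N.succ_pos (N.pred lo)) [::]).

Fixpoint setm (k : positive) (t : tree) : tree :=
  match k, t with
  | xH, Leaf => Node Leaf true Leaf
  | xH, Node l _ r => Node l true r
  | xO k', Leaf => Node (setm k' Leaf) false Leaf
  | xO k', Node l b r => Node (setm k' l) b r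
  | xI k', Leaf => Node Leaf false (setm k' Leaf)
  | xI k', Node l b r => Node l b (setm k' r)
  end.

Lemma markE A k t (c : tree -> A) : mark k t c = c (setm k t).
Proof. by elim: k t c => [k IH|k IH|] [|l b r] c //=; rewrite IH. Qed.

Lemma marked_setm k t : marked k (setm k t).
Proof. by elim: k t => [k IH|k IH|] [|l b r] //=. Qed.

Lemma marked_setm_mono j k t : marked j t -> marked j (setm k t).
Proof. by elim: k j t => [k IH|k IH|] [j|j|] [|l b r] //=; apply: IH. Qed.

Lemma mark_stepP A n q k t (c : tree -> A) : exists2 t', mark_step n q k t c = c t' &
  (forall j, marked j t -> marked j t') /\
  (forall j i, i < n -> Pos.to_nat j = Pos.to_nat k + i * Pos.to_nat q -> marked j t').
Proof.
elim: n k t => [|n IH] k t; first by exists t; [|split].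
rewrite /= markE; have [t' -> [h1 h2]] := IH (Pos.add k q) (setm k t).
exists t' => //; split=> [j /(@marked_setm_mono j k)/h1 //|j [|i] hi e].
  by have -> : j = k; [lia|apply/h1/marked_setm].
by apply: (h2 j i) => //; nia.
Qed.

Definition key_val (k : positive) : nat := (Pos.to_nat k).*2.-1.

Lemma sieveP A lo hi qs t (c : tree -> A) : exists2 t', sieve lo hi qs t c = c t' &
  (forall j, marked j t -> marked j t') /\
  (forall q k u, N.of_nat q \in qs -> odd q -> (lo <= Npos k /\ Npos k < hi)%num -> q <= u -> odd u ->
    key_val k = q * u -> marked k t').
Proof.
elim: qs t => [|q0 qs IH] t; first by exists t => //; split.
rewrite /=; have [t1 -> [m1 s1]] := mark_stepP (N.to_nat (N.succ (N.div hi q0) - first_mult lo q0))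
  (N.succ_pos (N.pred q0)) (N.succ_pos (q0 * first_mult lo q0 + N.div2 q0)) t
  (fun t => sieve lo hi qs t c).
have [t2 -> [m2 s2]] := IH t1; exists t2 => //; split=> [j /m1/m2 //|q k u].
rewrite inE => /orP[/eqP e|]; last exact: s2.
move=> oq [lok khi] qu ou kv; apply: m2; pose i := u./2.
have eu : u = i.*2.+1 by rewrite -[LHS]odd_double_half ou.
have qE : q = (q./2).*2.+1 by rewrite -[LHS]odd_double_half oq.
have e2 : N.div2 q0 = N.of_nat q./2.
  rewrite -e [in LHS]qE; have -> : N.of_nat (q./2).*2.+1 = N.succ_double (N.of_nat q./2) by lia.
  exact: N.div2_succ_double.
have q00 : (0 < q0)%num by lia.
have K : Pos.to_nat k = q * i + q./2 + 1.
  by move: kv; rewrite /key_val eu; nia.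
have i0 : (first_mult lo q0 <= N.of_nat i)%num.
  rewrite /first_mult e2; apply: N.max_lub; first by lia.
  suff : (lo / q0 < N.of_nat i + 2)%num by lia.
  by apply: N.Div0.div_lt_upper_bound; rewrite -e; nia.
have i1 : (N.of_nat i <= hi / q0)%num.
  by apply: N.div_le_lower_bound; rewrite -?e; nia.
apply: (s1 _ (i - N.to_nat (first_mult lo q0))); first by lia.
set f := first_mult lo q0 in i0 *.
have -> : Pos.to_nat (N.succ_pos (q0 * f + N.div2 q0)) = q * N.to_nat f + q./2 + 1.
  have := N.succ_pos_spec (q0 * f + N.div2 q0); rewrite e2 -e; nia.
have -> : Pos.to_nat (N.succ_pos (N.pred q0)) = q.
  by have := N.succ_pos_spec (N.pred q0); lia.
nia.
Qed.

Lemma mem_small_primes p : prime p -> odd p -> p < 700 -> N.of_nat p \in small_primes.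
Proof.
move=> pp op p7; apply: map_f; rewrite mem_filter pp mem_iota.
have := prime_gt1 pp; have : p != 2 by apply: contraTneq op => ->.
lia.
Qed.

Lemma unmarked_prime lo hi t' k : (hi <= 245000)%num ->
  (forall q k u, N.of_nat q \in [seq q <- small_primes | (q * q <? 2 * hi)%num] ->
    odd q -> (lo <= Npos k /\ Npos k < hi)%num -> q <= u -> odd u ->
    key_val k = q * u -> marked k t') ->
  (lo <= Npos k /\ Npos k < hi)%num -> 1 < Pos.to_nat k -> ~~ marked k t' -> prime (key_val k).
Proof.
move=> hi_le H klh k1; apply: contraR => np.
have om : odd (key_val k) by rewrite /key_val; lia.
have m0 : 0 < key_val k by rewrite /key_val; lia.
have m1 : 1 < key_val k by rewrite /key_val; lia.
have pp := pdiv_prime m1; have pd := pdiv_dvd (key_val k).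
have sq : pdiv (key_val k) ^ 2 <= key_val k.
  by rewrite leqNgt; apply: contra np => /ltn_pdiv2_prime->.
move: (pdiv _) pp pd sq => p pp /dvdnP[u e] sq.
have op : odd p by move: om; rewrite e oddM => /andP[].
have ou : odd u by move: om; rewrite e oddM => /andP[].
have p0 := prime_gt0 pp.
have pu : p <= u by move: sq; rewrite e expnS expn1 leq_mul2r; lia.
apply: (H p k u) => //; last by rewrite mulnC.
(* 2 * 245000 = 700^2, so the least prime factor is within reach of [small_primes]. *)
have lt : p * p < 2 * N.to_nat hi.
  by move: sq klh; rewrite expnS expn1 /key_val; lia.
rewrite mem_filter mem_small_primes //; last by nia.
rewrite andbT; apply/N.ltb_lt; lia.
Qed.

(** [k] is the next key to be read, so entry i belongs to key k - i - 1. *)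
Definition window_ok (k : positive) (w : seq bool) :=
  forall i, nth false w i -> prime ((Pos.to_nat k - i.+1).*2.-1).

(* Either alternative yields a suitable prime for every k with at most two prime factors. *)
Definition many_reps (n : nat) : Prop :=
  let e := (odd n).+1 in
  prime (n - e) \/ exists s, [/\ uniq s, size s = 3 &
    forall r, r \in s -> [/\ prime r, odd r & prime (n - e * r)]].

Lemma walkP mask w c : walk mask w c -> exists s, [/\ uniq s, size s = c.+1 &
  forall i, i \in s -> nth false mask i /\ nth false w i].
Proof.
elim: mask w c => [|m mask IH] [|b w] c //=.
have shift c' : walk mask w c' -> exists s, [/\ uniq s, size s = c'.+1, 0 \notin s &
  forall i, i \in s -> nth false (m :: mask) i /\ nth false (b :: w) i].
  move=> /IH[s [us ss H]]; exists (map S s); rewrite map_inj_uniq ?size_map //; last exact: succn_inj.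
  by split=> // [|i /mapP[j js ->]]; [apply/mapP; case|apply: H].
case: b shift => shift; last by move=> /shift[s [us ss _ H]]; exists s.
case: m shift => shift; last by move=> /shift[s [us ss _ H]]; exists s.
case: c => [_|c /shift[s [us ss s0 H]]].
  by exists [:: 0]; split=> // i; rewrite inE => /eqP ->.
exists (0 :: s); rewrite /= us ss s0; split=> // i; rewrite inE => /orP[/eqP -> //|]; exact: H.
Qed.

Lemma runP me mo t n k w :
  (forall i, nth false me i -> prime i.+1.*2.+1) ->
  (forall i, nth false mo i -> (i != 0) && prime i.+2) ->
  (forall j, Pos.to_nat k <= Pos.to_nat j < Pos.to_nat k + n -> ~~ marked j t -> prime (key_val j)) ->
  window_ok k w -> run me mo t n k w ->
  forall j, (Pos.to_nat k).*2 <= j < (Pos.to_nat k + n).*2 -> many_reps j.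
Proof.
move=> Hme Hmo; elim: n k w => [|n IH] k w Hk Hw; first by move=> _ j; lia.
rewrite /run -/run; set w' := _ :: w.
have Hw' : window_ok (Pos.succ k) w'.
  move=> [|i] /= h; first by have := Hk k ltac:(lia) h; rewrite /key_val; congr prime; lia.
  by have := Hw i h; congr prime; lia.
case We : (walk1 me w') => //; case Wo : (walk1 mo w') => // R j jk.
have [je|jne] := eqVneq j (Pos.to_nat k).*2.
  have od : odd j = false by lia.
  rewrite /many_reps od; move: We; rewrite /walk1 /w'.
  case b : (~~ _); last move=> /walkP[s [us ss H]].
    by move=> _; left; have := Hk k ltac:(lia) b; rewrite /key_val; congr prime; lia.
  right; exists [seq i.+1.*2.+1 | i <- s]; split; rewrite ?size_map //.
    by rewrite map_inj_uniq // => x y; lia.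
  move=> r /mapP[i /H[/Hme p1 /Hw p2] ->]; split=> //; first by lia.
  by move: p2; congr prime; lia.
have [jo|jno] := eqVneq j (Pos.to_nat k).*2.+1.
  have od : odd j = true by lia.
  rewrite /many_reps od; move: Wo; rewrite /walk1 /w'.
  case b : (~~ _); last move=> /walkP[s [us ss H]].
    by move=> _; left; have := Hk k ltac:(lia) b; rewrite /key_val; congr prime; lia.
  right; exists [seq i.+2 | i <- s]; split; rewrite ?size_map //.
    by rewrite map_inj_uniq // => x y; lia.
  move=> r /mapP[i /H[/Hmo/andP[i0 p1] /Hw p2] ->]; split=> //.
    have [e|//] := even_prime p1; lia.
  by move: p2; congr prime; lia.
apply: (IH (Pos.succ k) w') => //; last by lia.
by move=> l ll; apply: Hk; lia.
Qed.

Lemma run_fromP me mo t n0 n k w :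
  (forall i, nth false me i -> prime i.+1.*2.+1) ->
  (forall i, nth false mo i -> (i != 0) && prime i.+2) ->
  (forall j, Pos.to_nat k <= Pos.to_nat j < Pos.to_nat k + n0 + n ->
     ~~ marked j t -> prime (key_val j)) ->
  window_ok k w -> run_from me mo t n0 n k w ->
  forall j, (Pos.to_nat k + n0).*2 <= j < (Pos.to_nat k + n0 + n).*2 -> many_reps j.
Proof.
move=> Hme Hmo; elim: n0 k w => [|n0 IH] k w Hk Hw /=.
  by rewrite addn0 in Hk *; apply: runP.
move=> R j jk; apply: (IH (Pos.succ k) _ _ _ R) => //; last by lia.
  by move=> l ll; apply: Hk; lia.
move=> [|i] /= h; first by have := Hk k ltac:(lia) h; rewrite /key_val; congr prime; lia.
by have := Hw i h; congr prime; lia.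
Qed.

Lemma segmentP lo n0 n : (2 <= lo)%num -> (lo + N.of_nat n0 + N.of_nat n <= 245000)%num ->
  segment lo n0 n ->
  forall j, (N.to_nat lo + n0).*2 <= j < (N.to_nat lo + n0 + n).*2 -> many_reps j.
Proof.
move=> lo2 hi2; rewrite /segment; set hi := (_ + _ + _)%num in hi2 *.
set me := map _ _; set mo := map _ _.
have [t -> [_ H]] := sieveP lo hi [seq q <- small_primes | (q * q <? 2 * hi)%num] Leaf
  (fun t => run_from me mo t n0 n (N.succ_pos (N.pred lo)) [::]).
have kE : Pos.to_nat (N.succ_pos (N.pred lo)) = N.to_nat lo.
  by have := N.succ_pos_spec (N.pred lo); lia.
move=> R; rewrite -kE; apply: run_fromP R.
- move=> i; have [i4|i4] := ltnP i 400; last by rewrite nth_default ?size_map ?size_iota.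
  by rewrite (nth_map 0) ?size_iota // nth_iota // add1n.
- move=> i; have [i4|i4] := ltnP i 800; last by rewrite nth_default ?size_map ?size_iota.
  by rewrite (nth_map 0) ?size_iota // nth_iota // add1n.
- move=> j; rewrite kE => jj; apply: (unmarked_prime hi2 H); rewrite /hi; lia.
- by move=> i; rewrite nth_nil.
Qed.

(** Keys 2 to 17 fill the window, so the first test, at key 18, concerns n = 36 and 37. The later
    segments warm up on 1000 keys, more than the 800 entries of the longer mask. *)
Lemma segment_check1 : segment 2 16 (500 * 100). Proof. by vm_compute. Qed.
Lemma segment_check2 : segment 49000 1000 (500 * 100). Proof. by vm_compute. Qed.
Lemma segment_check3 : segment 99000 1000 (500 * 100). Proof. by vm_compute. Qed.
Lemma segment_check4 : segment 149000 1000 (500 * 100). Proof. by vm_compute. Qed.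

(** * Conclusion *)

Lemma exists_good_prime n a (qs : seq nat) : 400 * 1000 <= n -> coprime a 12 ->
  uniq qs -> size qs <= 2 -> (forall q, q \in qs -> prime q /\ 4 < q) ->
  exists p, [/\ prime p, p < n, p == a %[mod 12],
    (forall q, q \in qs -> ~~ (q %| n - p)) &
    (forall r, prime r -> 4 < r -> ~~ (r ^ 2 %| n - p))].
Proof.
move=> nN ca uq sq pq.
pose good p := [&& prime p, p == a %[mod 12], all (fun q => ~~ (q %| n - p)) qs
  & all (fun r => ~~ (r ^ 2 %| n - p)) (primes_sqr 1 n)].
have [/hasP[p]|bad] := boolP (has good (iota 0 n)).
  rewrite mem_iota => /andP[_ pn] /and4P[pp pa /allP Hq /allP Hr].
  exists p; split=> // r pr r4; apply/negP => rd.
  have : r \in primes_sqr 1 n.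
    rewrite mem_primes_sqr // pr r4 mul1n; have := dvdn_leq _ rd.
    by rewrite subn_gt0 => /(_ pn) h; apply: leq_trans h (leq_subr _ _).
  by move/Hr; rewrite rd.
have cover d : 0 < d <= n -> prime d -> d == a %[mod 12] ->
    exists2 m, m \in qs ++ sqr_moduli n qs & d == n %[mod m].
  move=> /andP[d0 dn] pd da.
  have sub r : r \in primes_sqr 1 n -> r ^ 2 %| n - d ->
      exists2 m, m \in qs ++ sqr_moduli n qs & d == n %[mod m].
    (* Squares of members of [qs] are not listed among the moduli, but r itself is, and r divides
       r^2. *)
    move=> rn rd; have [rq|rq] := boolP (r \in qs).
      exists r; first by rewrite mem_cat rq.
      by rewrite eq_sym eqn_mod_dvd // (dvdn_trans _ rd) // dvdn_exp.
    exists (r ^ 2); last by rewrite eq_sym eqn_mod_dvd.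
    rewrite mem_cat; apply/orP; right; apply/mapP; exists r => //.
    by rewrite mem_filter rq.
  have [dn1|] := ltnP d n.
    move/hasPn/(_ d): bad; rewrite mem_iota dn1 => /(_ isT).
    rewrite /good pd da /= negb_and => /orP[/allPn[q qq]|/allPn[r rr]]; rewrite negbK => dv.
      by exists q; [rewrite mem_cat qq|rewrite eq_sym eqn_mod_dvd].
    exact: (sub r).
  (* [psi] at n also counts d = n, which is not allowed as p; it is covered because n - d = 0 is
     divisible by 25. *)
  move=> nd; have -> : d = n by apply/eqP; rewrite eqn_leq dn.
  have m5 : 5 \in primes_sqr 1 n by rewrite mem_primes_sqr //=; lia.
  have := sub 5 m5; rewrite (_ : n - d = 0); last by lia.
  move=> /(_ isT)[m mm _]; exists m => //.
have s1 := psi_class_cover ca cover.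
have s2 := psi_killed_total_le n ca uq sq pq.
have n151 : 151 <= n by lia.
have s3 := psi12_ge n151 ca (up_logP (n %/ 200) (isT : 1 < 12)).
have s4 := excluded_lt_class nN.
exfalso; lra.
Qed.

Lemma squarefree_prime s : 0 < s -> (forall r, prime r -> ~~ (r ^ 2 %| s)) -> squarefree s.
Proof.
move=> s0 H; split=> // d ds; have d0 : 0 < d.
  by rewrite lt0n; apply: contraTneq ds => ->; rewrite exp0n // dvd0n -lt0n.
apply/eqP; apply: contraT => d1; have d2 : 1 < d by lia.
have /negP[] := H _ (pdiv_prime d2).
by apply: dvdn_trans ds; rewrite dvdn_exp2r ?pdiv_dvd.
Qed.

(** There are two units modulo 3 and two modulo 4, so in each case one differs from n, and the two
    choices combine modulo 12. *)
Lemma avoiding_class n : exists a, [/\ coprime a 12, n %% 3 != a %% 3 & n %% 4 != a %% 4].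
Proof.
have : all (fun r => has (fun a => (r %% 3 != a %% 3) && (r %% 4 != a %% 4)) [:: 1; 5; 7; 11])
  (iota 0 12) by [].
move=> /allP/(_ (n %% 12)); rewrite mem_iota ltn_mod => /(_ isT)/hasP[a aa].
rewrite !modn_dvdm // => /andP[h3 h4]; exists a; split=> //.
by move: aa; rewrite !inE => /or4P[]/eqP ->.
Qed.

Lemma large_case k n : 0 < k -> size (primes k) <= 2 -> odd k || ~~ odd n -> 400 * 1000 <= n ->
  exists p eta, [/\ prime p, p < n, squarefree_coprime k eta & n = p + eta].
Proof.
move=> k0 sk par nN; have [a [ca a3 a4]] := avoiding_class n.
pose qs := [seq q <- primes k | 4 < q].
have uq : uniq qs by rewrite filter_uniq ?primes_uniq.
have sq : size qs <= 2 by apply: leq_trans sk; rewrite size_filter count_size.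
have pq q : q \in qs -> prime q /\ 4 < q.
  by rewrite mem_filter mem_primes => /andP[q4 /and3P[pq _ _]].
have [p [pp pn pa Hq Hr]] := exists_good_prime nN ca uq sq pq.
have pn' := ltnW pn.
have p3 : p %% 3 = a %% 3.
  by rewrite -(modn_dvdm p (isT : 3 %| 12)) (eqP pa) modn_dvdm.
have p4 : p %% 4 = a %% 4.
  by rewrite -(modn_dvdm p (isT : 4 %| 12)) (eqP pa) modn_dvdm.
have n3 : ~~ (3 %| n - p) by rewrite -eqn_mod_dvd // p3.
have n4 : ~~ (4 %| n - p) by rewrite -eqn_mod_dvd // p4.
have op : odd p.
  have : odd a by move: ca; rewrite (_ : 12 = 2 * 6) // coprimeMr coprimen2 => /andP[].
  lia.
exists p, (n - p); split=> //; last by rewrite subnKC.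
have small r : prime r -> r <= 4 -> r = 2 \/ r = 3 by case: r => [|[|[|[|[|r]]]]] //; auto.
split.
  apply: squarefree_prime => [|r pr]; first by rewrite subn_gt0.
  have [r4|/(Hr r pr) //] := leqP r 4.
  case: (small r pr r4) => ->; first exact: n4.
  by apply: contra n3; apply: dvdn_trans.
rewrite /coprime; apply: contraT => g1.
have g0 : 0 < gcdn (n - p) k by rewrite gcdn_gt0 k0 orbT.
have g2 : 1 < gcdn (n - p) k by lia.
set q := pdiv (gcdn (n - p) k).
have prq : prime q := pdiv_prime g2.
have qn : q %| n - p by apply: dvdn_trans (pdiv_dvd _) (dvdn_gcdl _ _).
have qk : q %| k by apply: dvdn_trans (pdiv_dvd _) (dvdn_gcdr _ _).
have [q4|q4] := leqP q 4; last first.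
  by have /Hq : q \in qs; [rewrite mem_filter q4 mem_primes prq k0 qk|rewrite qn].
case: (small q prq q4) => e; last by move: qn; rewrite e (negbTE n3).
(* Since p is odd, 2 | n - p forces n odd, while 2 | k makes k even, against the parity
   hypothesis. *)
by move: qn qk par; rewrite e !dvdn2 oddB // op; case: (odd n); case: (odd k).
Qed.

Lemma squarefree_mul_prime e r : 0 < e < 3 -> prime r -> odd r -> squarefree (e * r).
Proof.
move=> /andP[e0 e3] pr ro; apply: squarefree_prime => [|l pl]; first by rewrite muln_gt0 e0 prime_gt0.
apply/negP; have [->|lr] := eqVneq l r.
  rewrite -mulnn dvdn_pmul2r ?prime_gt0 // => /(dvdn_leq e0) re.
  by case: r pr ro re => [|[|[|r]]] //; lia.
rewrite Gauss_dvdl; last by rewrite coprimeXl // prime_coprime // dvdn_prime2.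
move=> /(dvdn_leq e0); rewrite -mulnn; have := prime_gt1 pl; nia.
Qed.

Lemma small_case k n : 0 < k -> size (primes k) <= 2 -> odd k || ~~ odd n -> many_reps n ->
  exists p eta, [/\ prime p, p < n, squarefree_coprime k eta & n = p + eta].
Proof.
move=> k0 sk par; rewrite /many_reps; set e := (odd n).+1.
have e3 : 0 < e < 3 by rewrite /e; case: (odd n).
(* e = 2 occurs only for odd n, and then k is odd. *)
have ek : coprime e k.
  by move: par; rewrite /e; case: (odd n); rewrite ?coprime1n ?coprime2n ?orbF.
clearbody e; have fin eta : squarefree_coprime k eta -> prime (n - eta) ->
    exists p eta, [/\ prime p, p < n, squarefree_coprime k eta & n = p + eta].
  move=> se pe; have [eta0 _] := se.1; exists (n - eta), eta; have := prime_gt0 pe.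
  by rewrite subn_gt0 => h; split=> //; [rewrite ltn_subrL eta0 (leq_ltn_trans _ h)|rewrite subnK // ltnW].
case=> [pe|[s [us ss H]]].
  apply: (fin e) => //; split=> //; apply: squarefree_prime => [|r pr]; first by case/andP: e3.
  apply/negP => /dvdn_leq h; have /andP[e0 e2] := e3; have := h e0.
  by rewrite -mulnn; have := prime_gt1 pr; nia.
have [r rs rk] : exists2 r, r \in s & ~~ (r %| k).
  apply/hasP; apply: contraT => /hasPn nr; have : size s <= size (primes k).
    apply: uniq_leq_size => // r rs; have [pr _ _] := H r rs.
    by rewrite mem_primes pr k0 /= -[_ %| _]negbK; apply: nr.
  by rewrite ss; lia.
have [pr ro pe] := H r rs.
apply: (fin (e * r)) => //; split; first exact: squarefree_mul_prime.
by rewrite coprimeMl ek prime_coprime.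
Qed.

Lemma many_reps_small n : 36 <= n < 400 * 1000 -> many_reps n.
Proof.
move=> /andP[n36 nN].
have [h|h] := ltnP n (N.to_nat 2 + 16 + 500 * 100).*2.
  by apply: (segmentP _ _ segment_check1) => //; lia.
have [h2|h2] := ltnP n (N.to_nat 49000 + 1000 + 500 * 100).*2.
  by apply: (segmentP _ _ segment_check2) => //; lia.
have [h3|h3] := ltnP n (N.to_nat 99000 + 1000 + 500 * 100).*2.
  by apply: (segmentP _ _ segment_check3) => //; lia.
by apply: (segmentP _ _ segment_check4) => //; lia.
Qed.

Theorem theorem1p1 (k : nat) (hk1 : 1 < k) (hk2 : size (primes k) <= 2) :
  (odd k ->
     forall n : nat, 36 <= n ->
       exists p eta : nat,
         [/\ prime p, p < n, squarefree_coprime k eta & n = p + eta])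
  /\
  (~~ odd k ->
     forall n : nat, 36 <= n -> ~~ odd n ->
       exists p eta : nat,
         [/\ prime p, p < n, squarefree_coprime k eta & n = p + eta]).
Proof.
have k0 : 0 < k by lia.
have main n : 36 <= n -> odd k || ~~ odd n -> exists p eta : nat,
    [/\ prime p, p < n, squarefree_coprime k eta & n = p + eta].
  move=> n36 par; have [small|large] := ltnP n (400 * 1000); last exact: large_case.
  by apply: small_case => //; apply: many_reps_small; rewrite n36.
by split=> hk n n36 => [|hn]; apply: main => //; rewrite ?hk ?hn ?orbT.
Qed.
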